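(* Let $(\mathcal{C},\mathbb{E},\mathfrak{s})$ be an extriangulated category satisfying weak idempotent completeness (WIC), and let $\xi$ be a proper class of $\mathbb{E}$-triangles such that $\mathcal{C}$ has enough $\xi$-projectives and enough $\xi$-injectives. Let $M$ be an object in $\widetilde{\mathcal{GP}}(\xi)$ (i.e. $\xi\text{-}\mathcal{G}\mathrm{pd}\,M<\infty$) and let $n\ge 0$ be an integer. Then the following are equivalent: (1) $\xi\text{-}\mathcal{G}\mathrm{pd}\,M\leq n$; (2) $\xi\mathrm{xt}_{\xi}^{i}(M,Q)=0$ for any $Q\in\widetilde{\mathcal{P}}(\xi)$ and any $i\geq n+1$; (3) $\xi\mathrm{xt}_{\xi}^{i}(M,Q)=0$ for any $Q\in\mathcal{P}(\xi)$ and any $i\geq n+1$. Furthermore, $$\xi\text{-}\mathcal{G}\mathrm{pd}\,M=\sup\{i\in\mathbb{N}_0 \mid \xi\mathrm{xt}_{\xi}^{i}(M,Q)\neq 0 \text{ for some } Q\in\mathcal{P}(\xi)\}=\sup\{i\in\mathbb{N}_0 \mid \xi\mathrm{xt}_{\xi}^{i}(M,Q)\neq 0 \text{ for some } Q\in\widetilde{\mathcal{P}}(\xi)\},$$ where suprema are taken in $\mathbb{N}_0\cup\{\infty\}$ (so the supremum of the empty set is $0$).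
   Context: **Extriangulated categories (Nakaoka–Palu).** Let $\mathcal{C}$ be an additive category and $\mathbb{E}:\mathcal{C}^{\mathrm{op}}\times\mathcal{C}\to\mathrm{Ab}$ an additive bifunctor. For $\delta\in\mathbb{E}(C,A)$, $a:A\to A'$, $c:C'\to C$ write $a_*\delta=\mathbb{E}(C,a)(\delta)$, $c^*\delta=\mathbb{E}(c,A)(\delta)$. A morphism from $\delta\in\mathbb{E}(C,A)$ to $\delta'\in\mathbb{E}(C',A')$ is a pair $(a:A\to A',c:C\to C')$ with $a_*\delta=c^*\delta'$. Sequences $A\xrightarrow{x}B\xrightarrow{y}C$ and $A\xrightarrow{x'}B'\xrightarrow{y'}C$ are equivalent if there is an isomorphism $b:B\to B'$ with $bx=x'$, $y'b=y$; $[\,\cdot\,]$ denotes the class. A realization $\mathfrak{s}$ assigns to each $\delta\in\mathbb{E}(C,A)$ a class $\mathfrak{s}(\delta)=[A\xrightarrow{x}B\xrightarrow{y}C]$ such that for every morphism $(a,c):\delta\to\delta'$ with $\mathfrak{s}(\delta')=[A'\xrightarrow{x'}B'\xrightarrow{y'}C']$ there is $b:B\to B'$ with $bx=x'a$, $y'b=cy$. It is additive if $\mathfrak{s}(0)=[A\to A\oplus C\to C]$ and $\mathfrak{s}(\delta\oplus\delta')=\mathfrak{s}(\delta)\oplus\mathfrak{s}(\delta')$. If $\mathfrak{s}(\delta)=[A\xrightarrow{x}B\xrightarrow{y}C]$, one writes $A\xrightarrow{x}B\xrightarrow{y}C\overset{\delta}{\dashrightarrow}$, calls this an $\mathbb{E}$-triangle,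 calls $A\to B\to C$ a conflation, $x$ an inflation, $y$ a deflation. $(\mathcal{C},\mathbb{E},\mathfrak{s})$ is extriangulated if $\mathfrak{s}$ is an additive realization and: (ET3) for $\mathbb{E}$-triangles $A\xrightarrow{x}B\xrightarrow{y}C\overset{\delta}{\dashrightarrow}$, $A'\xrightarrow{x'}B'\xrightarrow{y'}C'\overset{\delta'}{\dashrightarrow}$ and $a,b$ with $bx=x'a$, there is $c$ with $cy=y'b$ and $a_*\delta=c^*\delta'$; (ET3)$^{\mathrm{op}}$ is the dual (given $b,c$ with $cy=y'b$, there is $a$). (ET4) for $\mathbb{E}$-triangles $A\xrightarrow{f}B\xrightarrow{f'}D\overset{\delta}{\dashrightarrow}$ and $B\xrightarrow{g}C\xrightarrow{g'}F\overset{\delta'}{\dashrightarrow}$ there are an object $E$, an $\mathbb{E}$-triangle $A\xrightarrow{h}C\xrightarrow{h'}E\overset{\delta''}{\dashrightarrow}$ with $h=gf$, and morphisms $d:D\to E$, $e:E\to F$ with $h'g=df'$, $eh'=g'$, such that $D\xrightarrow{d}E\xrightarrow{e}F$ realizes $f'_*\delta'$, $d^*\delta''=\delta$, and $f_*\delta''=e^*\delta'$; (ET4)$^{\mathrm{op}}$ is the dual. (WIC): if $gf$ is an inflation then $f$ is an inflation; if $gf$ is a deflation then $g$ is a deflation. **Proper classes.** A class $\xi$ of $\mathbb{E}$-triangles closed under isomorphisms is proper if: (a) it is closed under finite coproducts and contains all split $\mathbb{E}$-triangles (those with $\delta=0$); (b) it is closed under base change ($\delta\mapsto c^*\delta$)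 and cobase change ($\delta\mapsto a_*\delta$); (c) it is saturated: given $\mathbb{E}$-triangles $A_1\xrightarrow{x_1}B_1\xrightarrow{y_1}C\overset{\delta_1}{\dashrightarrow}$ and $A_2\xrightarrow{x_2}B_2\xrightarrow{y_2}C\overset{\delta_2}{\dashrightarrow}$, if the $\mathbb{E}$-triangle of $\delta_2$ and the $\mathbb{E}$-triangle $A_1\to M\to B_2$ realizing $y_2^*\delta_1$ are in $\xi$, then so is the $\mathbb{E}$-triangle of $\delta_1$. **Projectives and injectives.** $P$ is $\xi$-projective if for every $A\to B\to C\dashrightarrow$ in $\xi$ the sequence $0\to\mathcal{C}(P,A)\to\mathcal{C}(P,B)\to\mathcal{C}(P,C)\to0$ is exact; $\xi$-injective is dual. $\mathcal{P}(\xi)$, $\mathcal{I}(\xi)$ are the full subcategories of $\xi$-projectives and $\xi$-injectives. Enough $\xi$-projectives (resp. $\xi$-injectives): every $A$ admits an $\mathbb{E}$-triangle $K\to P\to A\dashrightarrow$ (resp. $A\to I\to K\dashrightarrow$) in $\xi$ with $P\in\mathcal{P}(\xi)$ (resp. $I\in\mathcal{I}(\xi)$). **Dimensions.** $\xi\text{-}\mathrm{pd}\,A=0$ iff $A\in\mathcal{P}(\xi)$; inductively $\xi\text{-}\mathrm{pd}\,A\le n$ if there is $K\to P\to A\dashrightarrow$ in $\xi$ with $P\in\mathcal{P}(\xi)$ and $\xi\text{-}\mathrm{pd}\,K\le n-1$; the dimension is the least such $n$, or $\infty$. $\widetilde{\mathcal{P}}(\xi)$ is the class of objects of finite $\xi$-projective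 dimension. **$\xi$-$\mathcal{G}$projectives.** An $\mathbb{E}$-triangle $A\to B\to C\dashrightarrow$ in $\xi$ is $\mathcal{C}(-,\mathcal{W})$-exact if $0\to\mathcal{C}(C,W)\to\mathcal{C}(B,W)\to\mathcal{C}(A,W)\to0$ is exact for all $W\in\mathcal{W}$. A complete $\xi$-projective resolution is a complex $\cdots\to P_1\to P_0\to P_{-1}\to\cdots$ with all $P_n\in\mathcal{P}(\xi)$ together with, for each $n\in\mathbb{Z}$, a $\mathcal{C}(-,\mathcal{P}(\xi))$-exact $\mathbb{E}$-triangle $K_{n+1}\xrightarrow{g_n}P_n\xrightarrow{f_n}K_n\dashrightarrow$ in $\xi$, with differential $d_n=g_{n-1}f_n$. The objects $K_n$ so arising are the $\xi$-$\mathcal{G}$projective objects, forming $\mathcal{GP}(\xi)$. The dimension $\xi\text{-}\mathcal{G}\mathrm{pd}$ is defined inductively as $\xi\text{-}\mathrm{pd}$ with $\mathcal{GP}(\xi)$ in place of $\mathcal{P}(\xi)$; $\widetilde{\mathcal{GP}}(\xi)$ is the class of objects of finite $\xi$-$\mathcal{G}$projective dimension. **Derived functors.** A $\xi$-projective resolution $\mathbf{P}\to A$ consists of $\mathbb{E}$-triangles $K_{n+1}\to P_n\to K_n\dashrightarrow$ in $\xi$ ($n\ge0$) with $K_0=A$, $P_n\in\mathcal{P}(\xi)$, with $\mathbf{P}$ the spliced complex $\cdots\to P_1\to P_0$; $\xi\mathrm{xt}^n_\xi(A,B)=H^n(\mathcal{C}(\mathbf{P},B))$ for $n\ge0$ (independent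 of the choice, and isomorphic to $H^n(\mathcal{C}(A,\mathbf{I}))$ for a $\xi$-injective coresolution $B\to\mathbf{I}$). *)

(* Defs.v *)
From HB Require Import structures.
From mathcomp Require Import all_boot all_algebra.
From mathcomp Require Import boolp.

Set Implicit Arguments.
Unset Strict Implicit.
Unset Printing Implicit Defensive.

Import GRing.Theory.
Local Open Scope ring_scope.

Declare Scope ecat_scope.
Delimit Scope ecat_scope with ecat.

Record preaddCat := PreaddCat {
  obj :> Type;
  hom : obj -> obj -> zmodType;
  idm : forall X, hom X X;
  comp : forall X Y Z, hom Y Z -> hom X Y -> hom X Z;
  compA : forall W X Y Z (h : hom Y Z) (g : hom X Y) (f : hom W X),
    comp h (comp g f) = comp (comp h g) f;
  comp1m : forall X Y (f : hom X Y), comp (idm Y) f = f;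
  compm1 : forall X Y (f : hom X Y), comp f (idm X) = f;
  compDl : forall X Y Z (g g' : hom Y Z) (f : hom X Y),
    comp (g + g') f = comp g f + comp g' f;
  compDr : forall X Y Z (g : hom Y Z) (f f' : hom X Y),
    comp g (f + f') = comp g f + comp g f'
}.

Arguments hom {p} X Y.
Arguments idm {p} X.

Notation "g \oc f" := (comp g f) (at level 40, left associativity) : ecat_scope.
Local Open Scope ecat_scope.

Definition is_iso (C : preaddCat) (X Y : C) (f : hom X Y) : Prop :=
  exists g : hom Y X, g \oc f = idm X /\ f \oc g = idm Y.

Definition is_zero (C : preaddCat) (Z : C) : Prop :=
  forall X : C, (forall f : hom X Z, f = 0) /\ (forall f : hom Z X, f = 0).

Record biproduct (C : preaddCat) (X Y S : C) := Biproduct {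
  in1 : hom X S;
  in2 : hom Y S;
  pr1 : hom S X;
  pr2 : hom S Y;
  pr1_in1 : pr1 \oc in1 = idm X;
  pr2_in2 : pr2 \oc in2 = idm Y;
  pr1_in2 : pr1 \oc in2 = 0;
  pr2_in1 : pr2 \oc in1 = 0;
  in_pr : in1 \oc pr1 + in2 \oc pr2 = idm S
}.

Record addCat := AddCat {
  preadd_of :> preaddCat;
  has_zero : exists Z : preadd_of, is_zero Z;
  has_biproduct : forall X Y : preadd_of,
    exists S : preadd_of, inhabited (biproduct X Y S)
}.

Definition hom_dsum (C : preaddCat) (X X' Y Y' SX SY : C)
    (bX : biproduct X X' SX) (bY : biproduct Y Y' SY)
    (f : hom X Y) (f' : hom X' Y') : hom SX SY :=
  in1 bY \oc f \oc pr1 bX + in2 bY \oc f' \oc pr2 bX.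

(* [E Z X] is the group E(Z, X), contravariant in Z and covariant in X;
   [push a d] is a_* d and [pull c d] is c^* d. *)
Record biadditive (C : addCat) := Biadditive {
  ext :> C -> C -> zmodType;
  push : forall Z X X' : C, hom X X' -> ext Z X -> ext Z X';
  pull : forall Z Z' X : C, hom Z' Z -> ext Z X -> ext Z' X;
  push1 : forall Z X (d : ext Z X), push (idm X) d = d;
  pushM : forall Z X X' X'' (a' : hom X' X'') (a : hom X X') (d : ext Z X),
    push (a' \oc a) d = push a' (push a d);
  pull1 : forall Z X (d : ext Z X), pull (idm Z) d = d;
  pullM : forall Z Z' Z'' X (c : hom Z' Z) (c' : hom Z'' Z') (d : ext Z X),
    pull (c \oc c') d = pull c' (pull c d);
  push_pull : forall Z Z' X X' (a : hom X X') (c : hom Z' Z) (d : ext Z X),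
    push a (pull c d) = pull c (push a d);
  pushDr : forall Z X X' (a : hom X X') (d d' : ext Z X),
    push a (d + d') = push a d + push a d';
  pullDr : forall Z Z' X (c : hom Z' Z) (d d' : ext Z X),
    pull c (d + d') = pull c d + pull c d';
  pushDl : forall Z X X' (a a' : hom X X') (d : ext Z X),
    push (a + a') d = push a d + push a' d;
  pullDl : forall Z Z' X (c c' : hom Z' Z) (d : ext Z X),
    pull (c + c') d = pull c d + pull c' d
}.

Definition ext_dsum (C : addCat) (E : biadditive C) (X X' Z Z' SX SZ : C)
    (bX : biproduct X X' SX) (bZ : biproduct Z Z' SZ)
    (d : E Z X) (d' : E Z' X') : E SZ SX :=
  push (in1 bX) (pull (pr1 bZ) d) + push (in2 bX) (pull (pr2 bZ) d').

Definition seq_equiv (C : preaddCat) (X Z Y Y' : C)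
    (x : hom X Y) (y : hom Y Z) (x' : hom X Y') (y' : hom Y' Z) : Prop :=
  exists b : hom Y Y', [/\ is_iso b, b \oc x = x' & y' \oc b = y].

(* A class of diagrams X -x-> Y -y-> Z decorated with d in E(Z, X).  This
   encodes both a realization s, with [s x y d] meaning s(d) = [X -x-> Y -y-> Z],
   and a class xi of E-triangles. *)
Definition triclass (C : addCat) (E : biadditive C) : Type :=
  forall X Y Z : C, hom X Y -> hom Y Z -> E Z X -> Prop.

Section Extriangulation.
Variables (C : addCat) (E : biadditive C) (s : triclass E).

Definition realization : Prop :=
  [/\ forall (X Z : C) (d : E Z X),
        exists (Y : C) (x : hom X Y) (y : hom Y Z), s x y d,
      forall (X Y Y' Z : C) (d : E Z X) (x : hom X Y) (y : hom Y Z)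
          (x' : hom X Y') (y' : hom Y' Z),
        s x y d -> (s x' y' d <-> seq_equiv x y x' y')
    & forall (X Y Z X' Y' Z' : C) (x : hom X Y) (y : hom Y Z) (d : E Z X)
          (x' : hom X' Y') (y' : hom Y' Z') (d' : E Z' X')
          (a : hom X X') (c : hom Z Z'),
        s x y d -> s x' y' d' -> push a d = pull c d' ->
        exists b : hom Y Y', b \oc x = x' \oc a /\ y' \oc b = c \oc y].

Definition additive_realization : Prop :=
  [/\ realization,
      forall (X Z S : C) (b : biproduct X Z S), s (in1 b) (pr2 b) (0 : E Z X)
    & forall (X Y Z X' Y' Z' SX SY SZ : C)
          (bX : biproduct X X' SX) (bY : biproduct Y Y' SY)
          (bZ : biproduct Z Z' SZ)
          (x : hom X Y) (y : hom Y Z) (d : E Z X)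
          (x' : hom X' Y') (y' : hom Y' Z') (d' : E Z' X'),
        s x y d -> s x' y' d' ->
        s (hom_dsum bX bY x x') (hom_dsum bY bZ y y') (ext_dsum bX bZ d d')].

Definition ET3 : Prop :=
  forall (X Y Z X' Y' Z' : C) (x : hom X Y) (y : hom Y Z) (d : E Z X)
      (x' : hom X' Y') (y' : hom Y' Z') (d' : E Z' X')
      (a : hom X X') (b : hom Y Y'),
    s x y d -> s x' y' d' -> b \oc x = x' \oc a ->
    exists c : hom Z Z', c \oc y = y' \oc b /\ push a d = pull c d'.

Definition ET3op : Prop :=
  forall (X Y Z X' Y' Z' : C) (x : hom X Y) (y : hom Y Z) (d : E Z X)
      (x' : hom X' Y') (y' : hom Y' Z') (d' : E Z' X')
      (b : hom Y Y') (c : hom Z Z'),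
    s x y d -> s x' y' d' -> c \oc y = y' \oc b ->
    exists a : hom X X', b \oc x = x' \oc a /\ push a d = pull c d'.

Definition ET4 : Prop :=
  forall (A B D X F : C) (f : hom A B) (f' : hom B D) (d1 : E D A)
      (g : hom B X) (g' : hom X F) (d2 : E F B),
    s f f' d1 -> s g g' d2 ->
    exists (G : C) (h' : hom X G) (d3 : E G A) (d : hom D G) (e : hom G F),
      s (g \oc f) h' d3 /\
      [/\ h' \oc g = d \oc f',
          e \oc h' = g',
          s d e (push f' d2),
          pull d d3 = d1
        & push f d3 = pull e d2].

Definition ET4op : Prop :=
  forall (A B D X F : C) (f : hom B A) (f' : hom D B) (d1 : E A D)
      (g : hom X B) (g' : hom F X) (d2 : E B F),
    s f' f d1 -> s g' g d2 ->
    exists (G : C) (h' : hom G X) (d3 : E A G) (d : hom G D) (e : hom F G),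
      s h' (f \oc g) d3 /\
      [/\ g \oc h' = f' \oc d,
          h' \oc e = g',
          s e d (pull f' d2),
          push d d3 = d1
        & pull f d3 = push e d2].

End Extriangulation.

Record extriCat := ExtriCat {
  add_of :> addCat;
  ext_of : biadditive add_of;
  etri : triclass ext_of;
  etri_additive : additive_realization etri;
  etri_ET3 : ET3 etri;
  etri_ET3op : ET3op etri;
  etri_ET4 : ET4 etri;
  etri_ET4op : ET4op etri
}.

Definition inflation (C : extriCat) (X Y : C) (x : hom X Y) : Prop :=
  exists (Z : C) (y : hom Y Z) (d : ext_of C Z X), etri x y d.

Definition deflation (C : extriCat) (Y Z : C) (y : hom Y Z) : Prop :=
  exists (X : C) (x : hom X Y) (d : ext_of C Z X), etri x y d.

Definition WIC (C : extriCat) : Prop :=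
  (forall (X Y Z : C) (f : hom X Y) (g : hom Y Z),
     inflation (g \oc f) -> inflation f) /\
  (forall (X Y Z : C) (f : hom X Y) (g : hom Y Z),
     deflation (g \oc f) -> deflation g).

Section ProperClass.
Variables (C : extriCat) (xi : triclass (ext_of C)).

Record proper_class : Prop := {
  proper_etri : forall (X Y Z : C) (x : hom X Y) (y : hom Y Z)
      (d : ext_of C Z X),
    xi x y d -> etri x y d;
  proper_iso : forall (X Y Z X' Y' Z' : C)
      (x : hom X Y) (y : hom Y Z) (d : ext_of C Z X)
      (x' : hom X' Y') (y' : hom Y' Z') (d' : ext_of C Z' X')
      (a : hom X X') (b : hom Y Y') (c : hom Z Z'),
    xi x y d -> etri x' y' d' ->
    is_iso a -> is_iso b -> is_iso c ->
    b \oc x = x' \oc a -> c \oc y = y' \oc b -> push a d = pull c d' ->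
    xi x' y' d';
  proper_dsum : forall (X Y Z X' Y' Z' SX SY SZ : C)
      (bX : biproduct X X' SX) (bY : biproduct Y Y' SY)
      (bZ : biproduct Z Z' SZ)
      (x : hom X Y) (y : hom Y Z) (d : ext_of C Z X)
      (x' : hom X' Y') (y' : hom Y' Z') (d' : ext_of C Z' X'),
    xi x y d -> xi x' y' d' ->
    xi (hom_dsum bX bY x x') (hom_dsum bY bZ y y') (ext_dsum bX bZ d d');
  proper_split : forall (X Y Z : C) (x : hom X Y) (y : hom Y Z),
    etri x y (0 : ext_of C Z X) -> xi x y 0;
  proper_base : forall (X Y Z Y' Z' : C) (x : hom X Y) (y : hom Y Z)
      (d : ext_of C Z X) (c : hom Z' Z) (x' : hom X Y') (y' : hom Y' Z'),
    xi x y d -> etri x' y' (pull c d) -> xi x' y' (pull c d);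
  proper_cobase : forall (X Y Z X' Y' : C) (x : hom X Y) (y : hom Y Z)
      (d : ext_of C Z X) (a : hom X X') (x' : hom X' Y') (y' : hom Y' Z),
    xi x y d -> etri x' y' (push a d) -> xi x' y' (push a d);
  proper_saturated : forall (A1 B1 A2 B2 M Z : C)
      (x1 : hom A1 B1) (y1 : hom B1 Z) (d1 : ext_of C Z A1)
      (x2 : hom A2 B2) (y2 : hom B2 Z) (d2 : ext_of C Z A2)
      (m : hom A1 M) (e : hom M B2),
    etri x1 y1 d1 -> etri x2 y2 d2 -> etri m e (pull y2 d1) ->
    xi x2 y2 d2 -> xi m e (pull y2 d1) ->
    xi x1 y1 d1
}.

End ProperClass.

(* [None] is infinity. *)
Definition enat := option nat.

Definition enat_le (u v : enat) : Prop :=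
  match u, v with
  | _, None => True
  | None, Some _ => False
  | Some m, Some n => (m <= n)%N
  end.

Definition enat_inf (S : nat -> Prop) : enat :=
  match pselect (exists n, `[< S n >]) with
  | left ex => Some (ex_minn ex)
  | right _ => None
  end.

(* The least upper bound in N u {oo}; in particular the empty set has
   supremum 0. *)
Definition enat_sup (S : nat -> Prop) : enat :=
  enat_inf (fun n => forall i, S i -> (i <= n)%N).

Definition short_exact (U V W : zmodType) (f : U -> V) (g : V -> W) : Prop :=
  [/\ injective f,
      forall v, g v = 0 <-> exists u, f u = v
    & forall w, exists v, g v = w].

Section Homological.
Variables (C : extriCat) (xi : triclass (ext_of C)).

Definition xi_projective (P : C) : Prop :=
  forall (X Y Z : C) (x : hom X Y) (y : hom Y Z) (d : ext_of C Z X),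
    xi x y d ->
    short_exact (fun f : hom P X => x \oc f) (fun f : hom P Y => y \oc f).

Definition xi_injective (I : C) : Prop :=
  forall (X Y Z : C) (x : hom X Y) (y : hom Y Z) (d : ext_of C Z X),
    xi x y d ->
    short_exact (fun f : hom Z I => f \oc y) (fun f : hom Y I => f \oc x).

Definition enough_projectives : Prop :=
  forall A : C, exists (K P : C) (x : hom K P) (y : hom P A)
    (d : ext_of C A K), xi_projective P /\ xi x y d.

Definition enough_injectives : Prop :=
  forall A : C, exists (I K : C) (x : hom A I) (y : hom I K)
    (d : ext_of C K A), xi_injective I /\ xi x y d.

Fixpoint res_dim_le (W : C -> Prop) (n : nat) (A : C) : Prop :=
  match n with
  | 0 => W A
  | n'.+1 => exists (K P : C) (x : hom K P) (y : hom P A) (d : ext_of C A K),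
      [/\ W P, xi x y d & res_dim_le W n' K]
  end.

Definition res_dim (W : C -> Prop) (A : C) : enat :=
  enat_inf (fun n => res_dim_le W n A).

Definition xi_pd : C -> enat := res_dim xi_projective.

Definition finite_xi_pd (A : C) : Prop := xi_pd A <> None.

Definition hom_to_exact (W : C -> Prop) (X Y Z : C)
    (x : hom X Y) (y : hom Y Z) : Prop :=
  forall V : C, W V ->
    short_exact (fun f : hom Z V => f \oc y) (fun f : hom Y V => f \oc x).

(* The differential P_(n+1) -> P_n of the underlying complex is determined by
   the triangles: it is [cres_g n \oc cres_f (n + 1)]. *)
Record complete_resolution := CompleteResolution {
  cres_P : int -> C;
  cres_K : int -> C;
  cres_g : forall n : int, hom (cres_K (n + 1)) (cres_P n);
  cres_f : forall n : int, hom (cres_P n) (cres_K n);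
  cres_d : forall n : int, ext_of C (cres_K n) (cres_K (n + 1));
  cres_proj : forall n, xi_projective (cres_P n);
  cres_xi : forall n, xi (cres_g n) (cres_f n) (cres_d n);
  cres_exact : forall n, hom_to_exact xi_projective (cres_g n) (cres_f n)
}.

Definition xi_Gprojective (A : C) : Prop :=
  exists (R : complete_resolution) (n : int), A = cres_K R n.

Definition xi_Gpd : C -> enat := res_dim xi_Gprojective.

Definition finite_xi_Gpd (A : C) : Prop := xi_Gpd A <> None.

Record projective_resolution (A : C) := ProjectiveResolution {
  pres_P : nat -> C;
  pres_K : nat -> C;
  pres_K0 : pres_K 0 = A;
  pres_g : forall n, hom (pres_K n.+1) (pres_P n);
  pres_f : forall n, hom (pres_P n) (pres_K n);
  pres_d : forall n, ext_of C (pres_K n) (pres_K n.+1);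
  pres_proj : forall n, xi_projective (pres_P n);
  pres_xi : forall n, xi (pres_g n) (pres_f n) (pres_d n)
}.

Fact projective_resolution_exists :
  enough_projectives -> forall A : C, inhabited (projective_resolution A).
Proof.
move=> enough A.
have /choice[K hK] := enough.
have /choice[P hP] := hK.
have tri B : {x : hom (K B) (P B) & {y : hom (P B) B &
    {d : ext_of C B (K B) | xi_projective (P B) /\ xi x y d}}}.
  by move: (hP B) => /cid[x] /cid[y] /cid[d h]; exists x, y, d.
pose k n := iter n K A.
split; apply: (@ProjectiveResolution _ (fun n => P (k n)) k erefl
  (fun n => projT1 (tri (k n))) (fun n => projT1 (projT2 (tri (k n))))
  (fun n => sval (projT2 (projT2 (tri (k n)))))) => n;
by case: (tri (k n)) => x [y [d []]].
Qed.

Definition pres_diff (A : C) (R : projective_resolution A) (n : nat) :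
    hom (pres_P R n.+1) (pres_P R n) :=
  pres_g R n \oc pres_f R n.+1.

End Homological.

Section Cohomology.
Variables (G : nat -> zmodType) (d : forall n, {additive G n -> G n.+1}).

Definition cocycle n : {pred G n} := [pred u | d n u == 0].

Fact cocycle_zmod_closed n : zmod_closed (@cocycle n).
Proof.
split=> [|u v]; rewrite !inE ?raddf0 // raddfB => /eqP-> /eqP->.
by rewrite subrr.
Qed.
HB.instance Definition _ n :=
  GRing.isZmodClosed.Build (G n) (@cocycle n) (cocycle_zmod_closed n).

Definition cocycles n := {u : G n | u \in @cocycle n}.
HB.instance Definition _ n := SubChoice.on (cocycles n).
HB.instance Definition _ n := [SubChoice_isSubZmodule of cocycles n by <:].

Definition coboundary n : {pred cocycles n} :=
  match n return {pred cocycles n} with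
  | 0 => [pred z | z == 0]
  | m.+1 => [pred z | `[< exists u : G m, d m u = val z >]]
  end.

Fact coboundary_zmod_closed n : zmod_closed (@coboundary n).
Proof.
case: n => [|n]; split=> [|u v]; rewrite !inE ?eqxx //.
- by move=> /eqP-> /eqP->; rewrite subrr.
- by apply/asboolP; exists 0; rewrite !raddf0.
- move=> /asboolP[u' hu] /asboolP[v' hv]; apply/asboolP.
  by exists (u' - v'); rewrite raddfB hu hv -raddfB.
Qed.
HB.instance Definition _ n :=
  GRing.isZmodClosed.Build (cocycles n) (@coboundary n)
    (coboundary_zmod_closed n).

Definition cohomology n : zmodType := Quotient.quot (@coboundary n).

End Cohomology.

Definition precomp (C : preaddCat) (X Y B : C) (f : hom X Y) (u : hom Y B) :
  hom X B := u \oc f.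

Fact precomp_zmod_morphism (C : preaddCat) (X Y B : C) (f : hom X Y) :
  zmod_morphism (@precomp C X Y B f).
Proof.
move=> u v; rewrite /precomp; apply: (addIr (v \oc f)).
by rewrite -compDl !subrK.
Qed.
HB.instance Definition _ (C : preaddCat) (X Y B : C) (f : hom X Y) :=
  GRing.isZmodMorphism.Build (hom Y B) (hom X B) (@precomp C X Y B f)
    (@precomp_zmod_morphism C X Y B f).

(* [xi_xt R B n] is xixt^n_xi(A, B), computed from the xi-projective resolution
   R of A. *)
Definition xi_xt (C : extriCat) (xi : triclass (ext_of C)) (A : C)
    (R : projective_resolution xi A) (B : C) (n : nat) : zmodType :=
  cohomology (G := fun n => hom (pres_P R n) B)
    (fun n => @precomp C _ _ B (pres_diff R n)) n.

Definition zero_group (V : zmodType) : Prop := forall v : V, v = 0.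

(* Main.v *)
(* The proof works up to stable retracts: [X] is a stable retract of [G] when
   [id_X] is a map factoring through [G] plus a map factoring through a
   xi-projective.  Syzygies preserve this relation, so Schanuel-type arguments
   need no choice of isomorphisms.  xi-Gprojectivity is rephrased as a coinductive
   condition: all syzygies of [X] are xi-Ext-orthogonal to the projectives (and maps
   from them to projectives are detected on projectives), and [X] has a cosyzygy of
   the same kind.  In this form it is closed under stable retracts and under
   xi-extensions, whence xi-Gpd M <= n iff the n-th syzygy K_n of any resolution is
   xi-Gprojective.  If K_(j+1) is xi-Gprojective and xixt^(j+1)(M, Q) = 0 for all
   projectives Q, maps K_(j+1) -> Q extend to P_j, so K_j is a stable retract of a
   cosyzygy of K_(j+1), hence xi-Gprojective; descending from a large index gives
   (3) => (1). *)
From mathcomp Require Import all_boot all_algebra.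
From mathcomp Require Import boolp.
Require Import Defs.

Set Implicit Arguments.
Unset Strict Implicit.
Unset Printing Implicit Defensive.

Import GRing.Theory.
Local Open Scope ring_scope.
Local Open Scope ecat_scope.

(** * Vanishing of cohomology groups *)

Lemma zero_group_quot (V : zmodType) (I : zmodClosed V) :
  zero_group (Quotient.quot I) <-> forall v, v \in I.
Proof.
have pi_eq0 v : (\pi_(Quotient.quot I)%qT v == 0) = (v \in I).
  by rewrite -[in RHS](subr0 v) (@Quotient.idealrBE V I) raddf0.
split=> [z0 v|h]; first by have /eqP := z0 (\pi%qT v); rewrite pi_eq0.
by apply: quotW => v; apply/eqP; rewrite pi_eq0.
Qed.

(** Stated in positive degrees, where a differential comes in; the vanishing conditions of the
    theorem start in degree [n + 1]. *)
Lemma zero_group_cohomologyS (G : nat -> zmodType)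
    (d : forall n, {additive G n -> G n.+1}) n :
  zero_group (cohomology d n.+1) <->
  forall u, d n.+1 u = 0 -> exists w, d n w = u.
Proof.
rewrite zero_group_quot; split=> [h u /eqP du|h [u du]].
  by have /asboolP := h (exist _ u du).
by apply/asboolP/h/eqP.
Qed.

(** * Preadditive categories and biproducts *)

Section Preadditive.
Variable C : preaddCat.
Implicit Types X Y Z S : C.

Lemma comp0m X Y Z (f : hom X Y) : (0 : hom Y Z) \oc f = 0.
Proof. by apply: (addrI (0 \oc f)); rewrite -compDl !addr0. Qed.

Lemma compm0 X Y Z (g : hom Y Z) : g \oc (0 : hom X Y) = 0.
Proof. by apply: (addrI (g \oc 0)); rewrite -compDr !addr0. Qed.

Lemma compNm X Y Z (g : hom Y Z) (f : hom X Y) : (- g) \oc f = - (g \oc f).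
Proof. by apply: (addrI (g \oc f)); rewrite -compDl !subrr comp0m. Qed.

Lemma compmN X Y Z (g : hom Y Z) (f : hom X Y) : g \oc (- f) = - (g \oc f).
Proof. by apply: (addrI (g \oc f)); rewrite -compDr !subrr compm0. Qed.

Lemma compBl X Y Z (g g' : hom Y Z) (f : hom X Y) :
  (g - g') \oc f = g \oc f - g' \oc f.
Proof. by rewrite compDl compNm. Qed.

Lemma compBr X Y Z (g : hom Y Z) (f f' : hom X Y) :
  g \oc (f - f') = g \oc f - g \oc f'.
Proof. by rewrite compDr compmN. Qed.

Lemma idm_iso X : is_iso (idm X).
Proof. by exists (idm X); rewrite compm1. Qed.

Definition biproduct_sym X Y S (b : biproduct X Y S) : biproduct Y X S.
Proof.
apply: (Biproduct (pr2_in2 b) (pr1_in1 b) (pr2_in1 b) (pr1_in2 b)).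
by rewrite addrC in_pr.
Defined.

Definition biproduct_zero X Z (hZ : is_zero Z) : biproduct X Z X.
Proof.
apply: (@Biproduct _ _ _ _ (idm X) 0 (idm X) 0).
- exact: compm1.
- by rewrite compm0; case: (hZ Z) => h _; rewrite [RHS]h.
- exact: compm0.
- exact: comp0m.
- by rewrite compm1 comp0m addr0.
Defined.

Definition zero_biproduct X Z (hZ : is_zero Z) : biproduct Z X X :=
  biproduct_sym (biproduct_zero X hZ).

Lemma biproduct_iso X Y S M (b : biproduct X Y S) (i : hom S M) :
  is_iso i -> {bM : biproduct X Y M |
    i \oc in1 b = in1 bM & pr2 bM \oc i = pr2 b}.
Proof.
move=> /cid[j [ji ij]].
have cancel Z W (f : hom Z S) (g : hom S W) : (g \oc j) \oc (i \oc f) = g \oc f.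
  by rewrite compA -(compA g) ji compm1.
unshelve eexists.
  apply: (@Biproduct _ _ _ _ (i \oc in1 b) (i \oc in2 b)
    (pr1 b \oc j) (pr2 b \oc j)); rewrite ?cancel.
  - exact: pr1_in1.
  - exact: pr2_in2.
  - exact: pr1_in2.
  - exact: pr2_in1.
  by rewrite !compA -!(compA i) -compDr -compDl in_pr comp1m.
- by [].
- by rewrite /= -compA ji compm1.
Qed.

End Preadditive.

(** * Zeros and differences in the extension bifunctor *)

Section Biadditive.
Variables (C : addCat) (E : biadditive C).
Implicit Types X Y Z : C.

Lemma pushr0 Z X X' (a : hom X X') : push a (0 : E Z X) = 0.
Proof. by apply: (addrI (push a 0)); rewrite -pushDr !addr0. Qed.

Lemma pullr0 Z Z' X (c : hom Z' Z) : pull c (0 : E Z X) = 0.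
Proof. by apply: (addrI (pull c 0)); rewrite -pullDr !addr0. Qed.

Lemma push0r Z X X' (d : E Z X) : push (0 : hom X X') d = 0.
Proof. by apply: (addrI (push 0 d)); rewrite -pushDl !addr0. Qed.

Lemma pull0r Z Z' X (d : E Z X) : pull (0 : hom Z' Z) d = 0.
Proof. by apply: (addrI (pull 0 d)); rewrite -pullDl !addr0. Qed.

Lemma pushBl Z X X' (a a' : hom X X') (d : E Z X) :
  push (a - a') d = push a d - push a' d.
Proof.
by apply: (addIr (push a' d)); rewrite -pushDl !subrK.
Qed.

Lemma pullBl Z Z' X (c c' : hom Z' Z) (d : E Z X) :
  pull (c - c') d = pull c d - pull c' d.
Proof.
by apply: (addIr (pull c' d)); rewrite -pullDl !subrK.
Qed.

End Biadditive.

(** * Exact sequences attached to an E-triangle *)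

Section Extriangulated.
Variable C : extriCat.
Implicit Types A B D X Y Z M : C.
Notation E := (ext_of C).

Lemma etri_realize X Z (d : E Z X) :
  exists Y (x : hom X Y) (y : hom Y Z), etri x y d.
Proof. by case: (etri_additive C) => -[h _ _] _ _; apply: h. Qed.

Lemma etri_seq_equiv X Y Y' Z (d : E Z X) (x : hom X Y) (y : hom Y Z)
    (x' : hom X Y') (y' : hom Y' Z) :
  etri x y d -> (etri x' y' d <-> seq_equiv x y x' y').
Proof. by case: (etri_additive C) => -[_ h _] _ _; apply: h. Qed.

Lemma etri_mor X Y Z X' Y' Z' (x : hom X Y) (y : hom Y Z) (d : E Z X)
    (x' : hom X' Y') (y' : hom Y' Z') (d' : E Z' X')
    (a : hom X X') (c : hom Z Z') :
  etri x y d -> etri x' y' d' -> push a d = pull c d' ->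
  exists b : hom Y Y', b \oc x = x' \oc a /\ y' \oc b = c \oc y.
Proof. by case: (etri_additive C) => -[_ _ h] _ _; apply: h. Qed.

Lemma etri_split X Z S (b : biproduct X Z S) : etri (in1 b) (pr2 b) (0 : E Z X).
Proof. by case: (etri_additive C) => _ h _; apply: h. Qed.

(** Comparing a triangle with this one and with [etri_idr] through (ET3) and its dual yields the
    exactness of the hom sequences below. *)
Lemma etri_idl X Z (hZ : is_zero Z) :
  etri (idm X) (0 : hom X Z) (0 : E Z X).
Proof. exact: (etri_split (biproduct_zero X hZ)). Qed.

Lemma etri_idr X Z (hZ : is_zero Z) :
  etri (0 : hom Z X) (idm X) (0 : E X Z).
Proof. exact: (etri_split (zero_biproduct X hZ)). Qed.

(** All realizations of the zero extension are equivalent, so the biproduct structure is transported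
    along the equivalence. *)
Lemma split_biproduct X Y Z (x : hom X Y) (y : hom Y Z) :
  etri x y (0 : E Z X) ->
  exists b : biproduct X Z Y, x = in1 b /\ y = pr2 b.
Proof.
move=> h; have [S [b]] := has_biproduct X Z.
have [i [ii e1 e2]] := (etri_seq_equiv x y (etri_split b)).1 h.
have [bM h1 h2] := biproduct_iso b ii.
exists bM; split; first by rewrite -h1 e1.
case: ii => j [ji ij].
have : (pr2 bM \oc i) \oc j = (y \oc i) \oc j by rewrite h2 e2.
by rewrite -!compA ij !compm1.
Qed.

Section LongExactSequence.
Variables (X Y Z : C) (x : hom X Y) (y : hom Y Z) (d : E Z X).
Hypothesis t : etri x y d.

Lemma etri_comp0 : y \oc x = 0.
Proof.
have [O hO] := has_zero C.
have [|c [h _]] := etri_ET3 (a := idm X) (b := x) (etri_idl X hO) t.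
  by rewrite !compm1.
by rewrite -h compm0.
Qed.

Lemma push_infl : push x d = 0.
Proof.
have [O hO] := has_zero C.
have [|c [_ ->]] := etri_ET3 (a := x) (b := idm Y) t (etri_idl Y hO).
  by [].
exact: pullr0.
Qed.

Lemma pull_defl : pull y d = 0.
Proof.
have [O hO] := has_zero C.
have [|a [_ <-]] := etri_ET3op (b := idm Y) (c := y) (etri_idr Y hO) t.
  by [].
exact: pushr0.
Qed.

Lemma hom_infl_exact B (f : hom Y B) : f \oc x = 0 -> exists c, f = c \oc y.
Proof.
move=> fx; have [O hO] := has_zero C.
have [|c [h _]] := etri_ET3 (a := 0) (b := f) t (etri_idr B hO).
  by rewrite comp0m.
by exists c; rewrite h comp1m.
Qed.

Lemma hom_defl_exact B (f : hom B Y) : y \oc f = 0 -> exists a, f = x \oc a.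
Proof.
move=> yf; have [O hO] := has_zero C.
have [|a [h _]] := etri_ET3op (b := f) (c := 0) (etri_idl B hO) t.
  by rewrite comp0m.
by exists a; rewrite -h compm1.
Qed.

(** Here [a] induces a map from the triangle of [d] to the split one on [B] and [Z]; its middle
    component, projected to [B], extends [a]. *)
Lemma push_eq0_extend B (a : hom X B) : push a d = 0 -> exists b, b \oc x = a.
Proof.
move=> ad; have [S [bS]] := has_biproduct B Z.
have [|b [h _]] := etri_mor (a := a) (c := idm Z) t (etri_split bS).
  by rewrite pullr0.
by exists (pr1 bS \oc b); rewrite -compA h compA pr1_in1 comp1m.
Qed.

Lemma pull_eq0_lift B (c : hom B Z) : pull c d = 0 -> exists b, y \oc b = c.
Proof.
move=> cd; have [S [bS]] := has_biproduct X B.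
have [|b [_ h]] := etri_mor (a := idm X) (c := c) (etri_split bS) t.
  by rewrite pushr0.
by exists (b \oc in2 bS); rewrite compA h -compA pr2_in2 compm1.
Qed.

(** Since [pull y e] vanishes, [y] lifts to the middle term of a realization of [e]; the dual of
    (ET3) then produces [a]. *)
Lemma pull_defl_exact B (e : E Z B) :
  pull y e = 0 -> exists a : hom X B, push a d = e.
Proof.
move=> ye; have [W [u [v h]]] := etri_realize e.
have [S [bS]] := has_biproduct B Y.
have [|b [_ hb]] := etri_mor (a := idm B) (c := y) (etri_split bS) h.
  by rewrite pushr0.
have [|a [_ ha]] := etri_ET3op (b := b \oc in2 bS) (c := idm Z) t h.
  by rewrite compA hb -compA pr2_in2 compm1 comp1m.
by exists a; rewrite ha pull1.
Qed.

(** The dual of (ET4) for the deflations [W -> Y -> Z] gives a triangle [B -> G -> X] realizing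
    [pull x e = 0]; its retraction [G -> B] pushes [d3] to the required [e']. *)
Lemma pull_infl_exact B (e : E Y B) :
  pull x e = 0 -> exists e' : E Z B, pull y e' = e.
Proof.
move=> xe; have [W [u [v h]]] := etri_realize e.
have [G [h' [d3 [p [q [_ [_ _ hpq _ hy]]]]]]] := etri_ET4op t h.
rewrite xe in hpq; have [b [eq _]] := split_biproduct hpq.
exists (push (pr1 b) d3).
by rewrite -push_pull hy -pushM eq pr1_in1 push1.
Qed.

End LongExactSequence.
End Extriangulated.

(** * Transport along isomorphisms, pullbacks and pushouts of E-triangles *)

Section ThirdObject.
Variable C : extriCat.
Implicit Types A B X Y Z M : C.
Notation E := (ext_of C).

(* Such a [phi] is unipotent: [(phi - 1)^2 = 0]. *)
Lemma etri_endo_iso X Y Z (x : hom X Y) (y : hom Y Z) (d : E Z X)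
    (phi : hom Y Y) :
  etri x y d -> phi \oc x = x -> y \oc phi = y -> is_iso phi.
Proof.
move=> t px yp.
have [|c hc] := hom_infl_exact t (f := phi - idm Y).
  by rewrite compBl px comp1m subrr.
have nn : (phi - idm Y) \oc (phi - idm Y) = 0.
  by rewrite {1}hc -compA compBr yp compm1 subrr compm0.
have : phi = idm Y + (phi - idm Y) by rewrite addrC subrK.
move: nn; set n := phi - idm Y => nn ->; exists (idm Y - n); split.
  by rewrite compBl comp1m compDr compm1 nn addr0 addrK.
by rewrite compDl comp1m compBr compm1 nn subr0 subrK.
Qed.

Lemma iso_of_comp X Y (b : hom X Y) (g : hom Y X) :
  is_iso (g \oc b) -> is_iso (b \oc g) -> is_iso b.
Proof.
move=> [l [l1 _]] [r [_ r1]]; rewrite compA in l1; rewrite -compA in r1.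
exists (l \oc g); split=> //.
by rewrite -[l \oc g]compm1 -r1 [X in b \oc X]compA l1 comp1m.
Qed.

(** The maps of triangles over [c] and [c'] compose to endomorphisms fixing both ends, invertible by
    [etri_endo_iso]; hence the middle map is an isomorphism. *)
Lemma etri_iso_pull X Y Z Z' (x : hom X Y) (y : hom Y Z) (d : E Z X)
    (c : hom Z' Z) (c' : hom Z Z') :
  etri x y d -> c \oc c' = idm Z -> c' \oc c = idm Z' ->
  etri x (c' \oc y) (pull c d).
Proof.
move=> t cc' c'c; have [W [u [v h]]] := etri_realize (pull c d).
have [|b [b1 b2]] := etri_mor (a := idm X) (c := c) h t; first by rewrite push1.
have [|g [g1 g2]] := etri_mor (a := idm X) (c := c') t h.
  by rewrite push1 -pullM cc' pull1.
rewrite !compm1 in b1 g1.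
apply/(etri_seq_equiv _ _ h); exists b; split=> //.
  apply: (@iso_of_comp _ _ b g).
    apply: (etri_endo_iso h); first by rewrite -compA b1.
    by rewrite compA g2 -compA b2 compA c'c comp1m.
  apply: (etri_endo_iso t); first by rewrite -compA g1.
  by rewrite compA b2 -compA g2 compA cc' comp1m.
by rewrite -compA b2 compA c'c comp1m.
Qed.

Lemma etri_iso_push X X' Y Z (x : hom X Y) (y : hom Y Z) (d : E Z X)
    (a : hom X X') (a' : hom X' X) :
  etri x y d -> a \oc a' = idm X' -> a' \oc a = idm X ->
  etri (x \oc a') y (push a d).
Proof.
move=> t aa' a'a; have [W [u [v h]]] := etri_realize (push a d).
have [|g [g1 g2]] := etri_mor (a := a) (c := idm Z) t h; first by rewrite pull1.
have [|b [b1 b2]] := etri_mor (a := a') (c := idm Z) h t.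
  by rewrite pull1 -pushM a'a push1.
rewrite !comp1m in b2 g2.
apply/(etri_seq_equiv _ _ h); exists b; split=> //.
apply: (@iso_of_comp _ _ b g).
  apply: (etri_endo_iso h); last by rewrite compA g2.
  by rewrite -compA b1 compA g1 -compA aa' compm1.
apply: (etri_endo_iso t); last by rewrite compA b2.
by rewrite -compA g1 compA b1 -compA a'a compm1.
Qed.

(** (ET4) for [A2 -> S -> A1] and [t] divides [M] by the summand [A2]; the quotient realizes
    [push (pr1 bS) m], hence is isomorphic to [B1]. *)
Lemma etri_pr A1 A2 S B1 M Z (bS : biproduct A1 A2 S) (x : hom S M)
    (y : hom M Z) (m : E Z S) (x1 : hom A1 B1) (y1 : hom B1 Z) :
  etri x y m -> etri x1 y1 (push (pr1 bS) m) ->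
  exists e : hom M B1, etri (x \oc in2 bS) e (pull y1 (push (pr2 bS) m)).
Proof.
move=> t t1.
have [G [h' [d3 [d [e [h [_ _ hde _ hd3]]]]]]] :=
  etri_ET4 (etri_split (biproduct_sym bS)) t.
have {}hd3 : d3 = pull e (push (pr2 bS) m).
  by rewrite -push_pull -hd3 -pushM pr2_in2 push1.
have [b [[b' [b'b bb']] _ eb]] := (etri_seq_equiv d e t1).1 hde.
exists (b' \oc h').
have -> : pull y1 (push (pr2 bS) m) = pull b d3 by rewrite hd3 -pullM eb.
exact: etri_iso_pull.
Qed.

Lemma etri_in Z1 Z2 S B1 M A (bS : biproduct Z1 Z2 S) (x : hom A M)
    (y : hom M S) (m : E S A) (x1 : hom A B1) (y1 : hom B1 Z1) :
  etri x y m -> etri x1 y1 (pull (in1 bS) m) ->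
  exists e : hom B1 M, etri e (pr2 bS \oc y) (push x1 (pull (in2 bS) m)).
Proof.
move=> t t1.
have [G [h' [d3 [d [e [h [_ _ hde _ hd3]]]]]]] :=
  etri_ET4op (etri_split bS) t.
have {}hd3 : d3 = push e (pull (in2 bS) m).
  by rewrite push_pull -hd3 -pullM pr2_in2 pull1.
have [b [[b' [b'b bb']] be _]] := (etri_seq_equiv e d t1).1 hde.
exists (h' \oc b).
have -> : push x1 (pull (in2 bS) m) = push b' d3.
  by rewrite hd3 -pushM -be compA b'b comp1m.
exact: etri_iso_push.
Qed.

(** The two extensions combine into [m] in [E Z S]; dividing its middle term [M] by either summand
    of [S] gives the two triangles. *)
Lemma etri_pullback A1 B1 A2 B2 Z (x1 : hom A1 B1) (y1 : hom B1 Z)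
    (d1 : E Z A1) (x2 : hom A2 B2) (y2 : hom B2 Z) (d2 : E Z A2) :
  etri x1 y1 d1 -> etri x2 y2 d2 ->
  exists M (m1 : hom A1 M) (e2 : hom M B2) (m2 : hom A2 M) (e1 : hom M B1),
    etri m1 e2 (pull y2 d1) /\ etri m2 e1 (pull y1 d2).
Proof.
move=> t1 t2; have [S [bS]] := has_biproduct A1 A2.
pose m := push (in1 bS) d1 + push (in2 bS) d2.
have m1 : push (pr1 bS) m = d1.
  by rewrite pushDr -!pushM pr1_in1 pr1_in2 push1 push0r addr0.
have m2 : push (pr2 bS) m = d2.
  by rewrite pushDr -!pushM pr2_in2 pr2_in1 push1 push0r add0r.
have [M [x [y t]]] := etri_realize m.
have [|e1 h1] := etri_pr (bS := bS) (x1 := x1) (y1 := y1) t; first by rewrite m1.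
have [|e2 h2] := etri_pr (bS := biproduct_sym bS) (x1 := x2) (y1 := y2) t.
  by rewrite /= m2.
move: h1 h2; rewrite /= m1 m2 => h1 h2.
by exists M, (x \oc in1 bS), e2, (x \oc in2 bS), e1.
Qed.

Lemma etri_pushout A B1 Z1 B2 Z2 (x1 : hom A B1) (y1 : hom B1 Z1)
    (d1 : E Z1 A) (x2 : hom A B2) (y2 : hom B2 Z2) (d2 : E Z2 A) :
  etri x1 y1 d1 -> etri x2 y2 d2 ->
  exists M (e2 : hom B2 M) (p1 : hom M Z1) (e1 : hom B1 M) (p2 : hom M Z2),
    etri e2 p1 (push x2 d1) /\ etri e1 p2 (push x1 d2).
Proof.
move=> t1 t2; have [S [bS]] := has_biproduct Z1 Z2.
pose m := pull (pr1 bS) d1 + pull (pr2 bS) d2.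
have m1 : pull (in1 bS) m = d1.
  by rewrite pullDr -!pullM pr1_in1 pr2_in1 pull1 pull0r addr0.
have m2 : pull (in2 bS) m = d2.
  by rewrite pullDr -!pullM pr2_in2 pr1_in2 pull1 pull0r add0r.
have [M [x [y t]]] := etri_realize m.
have [|e1 h1] := etri_in (bS := bS) (x1 := x1) (y1 := y1) t; first by rewrite m1.
have [|e2 h2] := etri_in (bS := biproduct_sym bS) (x1 := x2) (y1 := y2) t.
  by rewrite /= m2.
move: h1 h2; rewrite /= m1 m2 => h1 h2.
by exists M, e2, (pr1 bS \oc y), e1, (pr2 bS \oc y).
Qed.

End ThirdObject.

(** * Proper classes and xi-projectives *)

Section ProperClass.
Variables (C : extriCat) (xi : triclass (ext_of C)).
Hypothesis hxi : proper_class xi.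
Implicit Types A B K P Q X Y Z M : C.
Notation E := (ext_of C).

(** By closure under isomorphisms, membership of a triangle in [xi] depends only on its extension;
    this predicate is the resulting subfunctor of [E]. *)
Definition xi_ext X Z (d : E Z X) : Prop :=
  exists Y (x : hom X Y) (y : hom Y Z), xi x y d.

Lemma xi_etri X Y Z (x : hom X Y) (y : hom Y Z) (d : E Z X) :
  xi x y d -> etri x y d.
Proof. exact: (proper_etri hxi). Qed.

Lemma etri_xi X Y Z (x : hom X Y) (y : hom Y Z) (d : E Z X) :
  etri x y d -> xi_ext d -> xi x y d.
Proof.
move=> t [W [u [v h]]].
have [b [bi bu vb]] := (etri_seq_equiv x y (xi_etri h)).1 t.
apply: (proper_iso hxi h t (idm_iso _) bi (idm_iso _)).
- by rewrite compm1.
- by rewrite comp1m.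
by rewrite push1 pull1.
Qed.

Lemma xi_ext_pull X Z Z' (c : hom Z' Z) (d : E Z X) :
  xi_ext d -> xi_ext (pull c d).
Proof.
move=> [Y [x [y h]]]; have [W [u [v t]]] := etri_realize (pull c d).
by exists W, u, v; apply: (proper_base hxi h t).
Qed.

Lemma xi_ext_push X X' Z (a : hom X X') (d : E Z X) :
  xi_ext d -> xi_ext (push a d).
Proof.
move=> [Y [x [y h]]]; have [W [u [v t]]] := etri_realize (push a d).
by exists W, u, v; apply: (proper_cobase hxi h t).
Qed.

Lemma xi_xi_ext X Y Z (x : hom X Y) (y : hom Y Z) (d : E Z X) :
  xi x y d -> xi_ext d.
Proof. by move=> h; exists Y, x, y. Qed.

Lemma xi_split X Z S (b : biproduct X Z S) : xi (in1 b) (pr2 b) 0.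
Proof. by apply: (proper_split hxi); apply: etri_split. Qed.

(** (ET3) exhibits [d] as a base change of [d']. *)
Lemma xi_of_infl X Y Z B Z' (x : hom X Y) (y : hom Y Z) (d : E Z X)
    (x' : hom X B) (y' : hom B Z') (d' : E Z' X) (k : hom Y B) :
  etri x y d -> xi x' y' d' -> k \oc x = x' -> xi x y d.
Proof.
move=> t h kx; apply: (etri_xi t).
have [|c [_]] := etri_ET3 (a := idm X) (b := k) t (xi_etri h).
  by rewrite compm1.
by rewrite push1 => ->; apply/xi_ext_pull/(xi_xi_ext h).
Qed.

Lemma xi_of_defl X Y Z X' B (x : hom X Y) (y : hom Y Z) (d : E Z X)
    (x' : hom X' B) (y' : hom B Z) (d' : E Z X') (k : hom B Y) :
  etri x y d -> xi x' y' d' -> y \oc k = y' -> xi x y d.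
Proof.
move=> t h yk; apply: (etri_xi t).
have [|a [_]] := etri_ET3op (b := k) (c := idm Z) (xi_etri h) t.
  by rewrite comp1m.
by rewrite pull1 => <-; apply/xi_ext_push/(xi_xi_ext h).
Qed.

(** Exactness in the middle comes from the hom sequence of the E-triangle. *)
Lemma xi_projP P : xi_projective xi P <->
  forall X Y Z (x : hom X Y) (y : hom Y Z) (d : E Z X), xi x y d ->
    (forall a : hom P X, x \oc a = 0 -> a = 0) /\
    (forall c : hom P Z, exists b, y \oc b = c).
Proof.
split=> h X Y Z x y d t; have := h _ _ _ _ _ _ t.
  move=> [inj _ surj]; split=> // a xa; apply: inj; by rewrite xa compm0.
move=> [inj surj]; split=> //.
- move=> a a' /eqP; rewrite -subr_eq0 -compBr => /eqP/inj/eqP.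
  by rewrite subr_eq0 => /eqP.
- move=> b; split; first by move/(hom_defl_exact (xi_etri t)) => [a ->]; exists a.
  by move=> [a <-]; rewrite compA (etri_comp0 (xi_etri t)) comp0m.
Qed.

Lemma proj_lift P X Y Z (x : hom X Y) (y : hom Y Z) (d : E Z X) :
  xi_projective xi P -> xi x y d -> forall c : hom P Z, exists b, y \oc b = c.
Proof. by move=> /xi_projP hP /hP[]. Qed.

Lemma proj_mono P X Y Z (x : hom X Y) (y : hom Y Z) (d : E Z X) :
  xi_projective xi P -> xi x y d -> forall a : hom P X, x \oc a = 0 -> a = 0.
Proof. by move=> /xi_projP hP /hP[]. Qed.

Lemma proj_pull0 P X Z (d : E Z X) (c : hom P Z) :
  xi_projective xi P -> xi_ext d -> pull c d = 0.
Proof.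
move=> hP [Y [x [y h]]]; have [b <-] := proj_lift hP h c.
by rewrite pullM (pull_defl (xi_etri h)) pullr0.
Qed.

Lemma proj_ext0 P X (d : E P X) : xi_projective xi P -> xi_ext d -> d = 0.
Proof. by move=> hP /(proj_pull0 (idm P) hP); rewrite pull1. Qed.

Lemma proj_biproduct P P' S (b : biproduct P P' S) :
  xi_projective xi P -> xi_projective xi P' -> xi_projective xi S.
Proof.
move=> hP hP'; apply/xi_projP => X Y Z x y d h; split=> [a xa|c].
  rewrite -[a]compm1 -(in_pr b) compDr !compA.
  rewrite (proj_mono hP h (a := a \oc in1 b)) ?compA ?xa ?comp0m //.
  rewrite (proj_mono hP' h (a := a \oc in2 b)) ?compA ?xa ?comp0m //.
  by rewrite addr0.
have [u hu] := proj_lift hP h (c \oc in1 b).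
have [v hv] := proj_lift hP' h (c \oc in2 b).
exists (u \oc pr1 b + v \oc pr2 b).
by rewrite compDr !compA hu hv -!compA -compDr in_pr compm1.
Qed.

Lemma proj_zero Z : is_zero Z -> xi_projective xi Z.
Proof.
move=> hZ; apply/xi_projP => X Y W x y d h; split=> [a _|c].
  exact: (hZ X).2.
by exists 0; rewrite compm0; apply/esym/(hZ W).2.
Qed.

Lemma inj_extend I X Y Z (x : hom X Y) (y : hom Y Z) (d : E Z X) :
  xi_injective xi I -> xi x y d -> forall a : hom X I, exists b, b \oc x = a.
Proof. by move=> hI /hI[]. Qed.

Hypothesis hP : enough_projectives xi.

(** A [xi]-deflation from a projective onto [A] lifts along [f] and then along [g], so it factors
    through the composite. *)
Lemma xi_defl_comp A B D F G X (f' : hom D B) (f : hom B A) (d1 : E A D)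
    (g' : hom F X) (g : hom X B) (d2 : E B F) (h : hom G X) (d3 : E A G) :
  xi f' f d1 -> xi g' g d2 -> etri h (f \oc g) d3 -> xi h (f \oc g) d3.
Proof.
move=> h1 h2 t; have [K [P [x [y [d [projP hxy]]]]]] := hP A.
have [b hb] := proj_lift projP h1 y.
have [c hc] := proj_lift projP h2 b.
by apply: (xi_of_defl t hxy (k := c)); rewrite -compA hc.
Qed.

(** * Stable retracts and orthogonality to projectives *)

Definition stable_retract X G : Prop :=
  exists P (a : hom X G) (b : hom G X) (t : hom X P) (f : hom P X),
    xi_projective xi P /\ idm X = b \oc a + f \oc t.

Lemma retract_stable X G (i : hom X G) (r : hom G X) :
  r \oc i = idm X -> stable_retract X G.
Proof.
move=> ri; have [O hO] := has_zero C.
exists O, i, r, 0, 0; split; first exact: (proj_zero hO).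
by rewrite ri comp0m addr0.
Qed.

Lemma stable_retract_addl X P S (b : biproduct X P S) : stable_retract X S.
Proof. exact: (retract_stable (pr1_in1 b)). Qed.

Lemma stable_retract_addr X P S (b : biproduct X P S) :
  xi_projective xi P -> stable_retract S X.
Proof.
by move=> hP'; exists P, (pr1 b), (in1 b), (pr2 b), (in2 b); rewrite in_pr.
Qed.

(** The maps [a] and [b] induce [aK] and [bK] on syzygies because extensions in [xi] vanish on
    projectives. The map [idm K - bK \oc aK] pushes [d] to [pull (f \oc t) d = 0], so it extends
    over [P]. *)
Lemma stable_retract_syzygy X G K P K' P' (x : hom K P) (y : hom P X)
    (d : E X K) (x' : hom K' P') (y' : hom P' G) (d' : E G K') :
  xi_projective xi P -> xi_projective xi P' -> xi x y d -> xi x' y' d' ->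
  stable_retract X G -> stable_retract K K'.
Proof.
move=> projP projP' h h' [P0 [a [b [t [f [projP0 e]]]]]].
have [|aK hK] := pull_defl_exact (xi_etri h) (e := pull a d').
  by rewrite -pullM (proj_pull0 _ projP (xi_xi_ext h')).
have [|bK hbK] := pull_defl_exact (xi_etri h') (e := pull b d).
  by rewrite -pullM (proj_pull0 _ projP' (xi_xi_ext h)).
have [|r hr] := push_eq0_extend (xi_etri h) (a := idm K - bK \oc aK).
  rewrite pushBl push1 pushM hK push_pull hbK.
  rewrite -[X in X - _]pull1 e pullDl !pullM.
  by rewrite (proj_pull0 f projP0 (xi_xi_ext h)) pullr0 addr0 subrr.
by exists P, aK, bK, x, r; rewrite hr addrC subrK.
Qed.

(* The first clause says that [hom X Q -> hom P Q] is injective for a xi-deflation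
   [P -> X] from a projective, which is not automatic since deflations need not
   be epimorphisms. *)
Definition orthogonal X Q : Prop :=
  (forall u : hom X Q,
     (forall P (p : hom P X), xi_projective xi P -> u \oc p = 0) -> u = 0) /\
  (forall d : E X Q, xi_ext d -> d = 0).

Definition Porthogonal X : Prop :=
  forall Q, xi_projective xi Q -> orthogonal X Q.

Definition retract_closed (W : C -> Prop) : Prop :=
  forall X G, stable_retract X G -> W G -> W X.

Definition extension_closed (W : C -> Prop) : Prop :=
  forall X Y Z (x : hom X Y) (y : hom Y Z) (d : E Z X),
    xi x y d -> W X -> W Z -> W Y.

(** Quantifying over all projective presentations keeps the condition free of a chosen
    resolution. *)
Fixpoint on_syzygies (W : C -> Prop) (k : nat) (X : C) : Prop :=
  match k with
  | 0 => W X
  | k'.+1 => forall K P (x : hom K P) (y : hom P X) (d : E X K),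
      xi_projective xi P -> xi x y d -> on_syzygies W k' K
  end.

Lemma Porthogonal_retract_closed : retract_closed Porthogonal.
Proof.
move=> X G [P0 [a [b [t [f [projP0 e]]]]]] hG Q projQ.
have [hu hd] := hG Q projQ; split=> [u hyp|d hyp].
  rewrite -[u]compm1 e compDr !compA (hyp _ f projP0) comp0m addr0.
  rewrite (hu (u \oc b)) ?comp0m // => P p projP.
  by rewrite -compA hyp.
rewrite -[d]pull1 e pullDl !pullM (hd (pull b d)) ?pullr0 ?add0r.
  by rewrite (proj_pull0 _ projP0 hyp) pullr0.
exact: xi_ext_pull.
Qed.

Lemma Porthogonal_extension_closed : extension_closed Porthogonal.
Proof.
move=> X Y Z x y d h hX hZ Q projQ.
have [uX dX] := hX Q projQ; have [uZ dZ] := hZ Q projQ.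
split=> [u hyp|e he].
  have ux : u \oc x = 0.
    by apply: uX => P p projP; rewrite -compA hyp.
  have [v hv] := hom_infl_exact (xi_etri h) ux.
  rewrite hv (uZ v) ?comp0m // => P p projP.
  have [q <-] := proj_lift projP h p.
  by rewrite compA -hv hyp.
have [|e' he'] := pull_infl_exact (xi_etri h) (e := e).
  exact/dX/xi_ext_pull.
rewrite -he' (dZ e') ?pullr0 //.
(* Applying [dZ] requires [e'] to lie in [xi]; saturation deduces this from [pull y e' = e]. *)
have [B1 [u [v t]]] := etri_realize e'.
have [M [m [n tm]]] := etri_realize (pull y e').
exists B1, u, v; apply: (proper_saturated hxi t (xi_etri h) tm h).
by apply: (etri_xi tm); rewrite he'.
Qed.

(** * Closure properties passed to syzygies *)

Lemma on_syzygies_retract_closed W k :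
  retract_closed W -> retract_closed (on_syzygies W k).
Proof.
move=> hW; elim: k => //= k IH X G hXG hG K P x y d projP h.
have [K' [P' [x' [y' [d' [projP' h']]]]]] := hP G.
apply: IH (hG _ _ _ _ _ projP' h').
exact: (stable_retract_syzygy projP projP' h h').
Qed.

(** The pullback of the first triangle along [p] splits, since [P] is projective; so the middle term
    of the pullback is a biproduct of [A] and [P]. *)
Lemma xi_rotate A B D K P (x : hom A B) (y : hom B D) (d : E D A)
    (k : hom K P) (p : hom P D) (e : E D K) :
  xi x y d -> xi_projective xi P -> xi k p e ->
  exists M (b : biproduct A P M) (m : hom K M) (n : hom M B) (f : E B K),
    xi m n f.
Proof.
move=> h projP h'.
have [M [m1 [e2 [m2 [e1 [t1 t2]]]]]] := etri_pullback (xi_etri h) (xi_etri h').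
rewrite (proj_pull0 p projP (xi_xi_ext h)) in t1.
have [b _] := split_biproduct t1; exists M, b, m2, e1, (pull y e).
exact/(etri_xi t2)/xi_ext_pull/(xi_xi_ext h').
Qed.

(** A horseshoe argument: [P -> Y -> Z] has a syzygy [G] of [Z] as kernel, with [K -> G -> X] in
    [xi]. Rotating along a presentation of [X] makes [K], up to a projective summand, an extension
    of [G] by the syzygy [KX]. *)
Lemma on_syzygies_extension_closed W k :
  retract_closed W -> extension_closed W -> extension_closed (on_syzygies W k).
Proof.
move=> hW eW; elim: k => //= k IH X Y Z x y d h hX hZ K P p q e projP hK.
have [G [g [d3 [u [v [t [_ _ tuv _ _]]]]]]] := etri_ET4op (xi_etri h) (xi_etri hK).
have hG := xi_defl_comp h hK t.
have huv := etri_xi tuv (xi_ext_pull x (xi_xi_ext hK)).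
have [KX [PX [x' [y' [d' [projPX h']]]]]] := hP X.
have [M [b [m [n [f hM]]]]] := xi_rotate huv projPX h'.
apply: (on_syzygies_retract_closed hW (stable_retract_addl b)).
exact: (IH _ _ _ _ _ _ hM (hX _ _ _ _ _ projPX h') (hZ _ _ _ _ _ projP hG)).
Qed.

Definition syzygy_orthogonal X : Prop :=
  forall k, on_syzygies Porthogonal k X.

Lemma syzygy_orthogonal_retract_closed : retract_closed syzygy_orthogonal.
Proof.
move=> X G h hG k.
exact: (on_syzygies_retract_closed Porthogonal_retract_closed h (hG k)).
Qed.

Lemma syzygy_orthogonal_extension_closed : extension_closed syzygy_orthogonal.
Proof.
move=> X Y Z x y d h hX hZ k.
exact: (on_syzygies_extension_closed Porthogonal_retract_closed
  Porthogonal_extension_closed h (hX k) (hZ k)).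
Qed.

Lemma syzygy_orthogonal0 X : syzygy_orthogonal X -> Porthogonal X.
Proof. by move=> /(_ 0). Qed.

Lemma syzygy_orthogonalS X K P (x : hom K P) (y : hom P X) (d : E X K) :
  xi_projective xi P -> xi x y d -> syzygy_orthogonal X -> syzygy_orthogonal K.
Proof. by move=> projP h hX k; apply: (hX k.+1 _ _ _ _ _ projP h). Qed.

Lemma proj_orthogonal P Q : xi_projective xi P -> orthogonal P Q.
Proof.
move=> projP; split=> [u /(_ P (idm P) projP)|d]; first by rewrite compm1.
exact: proj_ext0.
Qed.

Lemma proj_syzygy_orthogonal P : xi_projective xi P -> syzygy_orthogonal P.
Proof.
move=> projP k; elim: k P projP => [|k IH] P projP /=.
  by move=> Q _; apply: proj_orthogonal.
move=> K P' x y d projP' h.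
have d0 := proj_ext0 projP (xi_xi_ext h); rewrite d0 in h.
have [b _] := split_biproduct (xi_etri h).
apply: (on_syzygies_retract_closed Porthogonal_retract_closed
  (stable_retract_addl b)).
exact: IH.
Qed.

(** * Consequences of orthogonality for hom sequences *)

Lemma orthogonal_extend X K B Q (x : hom K B) (y : hom B X) (d : E X K) :
  orthogonal X Q -> xi x y d -> forall v : hom K Q, exists w, w \oc x = v.
Proof.
move=> [_ hX] h v; apply: (push_eq0_extend (xi_etri h)).
exact/hX/xi_ext_push/(xi_xi_ext h).
Qed.

Lemma orthogonal_monic X K P Q (x : hom K P) (y : hom P X) (d : E X K) :
  orthogonal X Q -> xi x y d ->
  forall u : hom X Q, u \oc y = 0 -> u = 0.
Proof.
move=> [hX _] h u uy; apply: hX => P' p projP'.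
by have [q <-] := proj_lift projP' h p; rewrite compA uy comp0m.
Qed.

Lemma Porthogonal_exact X K P (x : hom K P) (y : hom P X) (d : E X K) :
  xi x y d -> Porthogonal X -> hom_to_exact (xi_projective xi) x y.
Proof.
move=> h hX V projV; split.
- move=> a a' /eqP; rewrite -subr_eq0 -compBl => /eqP aa.
  apply/eqP; rewrite -subr_eq0; apply/eqP.
  exact: (orthogonal_monic (hX V projV) h).
- move=> u; split=> [/(hom_infl_exact (xi_etri h))[c ->]|[c <-]].
    by exists c.
  by rewrite -compA (etri_comp0 (xi_etri h)) compm0.
exact: (orthogonal_extend (hX V projV) h).
Qed.

(** As [P] is projective, every extension of [X] by [Q] in [xi] is [push a d] for some
    [a : hom K Q], and [a] extends over [P]. *)
Lemma exact_Porthogonal X K P (x : hom K P) (y : hom P X) (d : E X K) :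
  xi x y d -> xi_projective xi P -> hom_to_exact (xi_projective xi) x y ->
  Porthogonal X.
Proof.
move=> h projP ex Q projQ; have [inj _ surj] := ex Q projQ.
split=> [u hu|e he]; first by apply: inj; rewrite hu // comp0m.
have [|a <-] := pull_defl_exact (xi_etri h) (e := e).
  exact: proj_pull0.
have [b <-] := surj a.
by rewrite pushM (push_infl (xi_etri h)) pushr0.
Qed.

(** Dimension shifting in [Q]. Both halves of orthogonality are carried together, and the induction
    hypothesis is used for [X] and for its syzygy [K]. *)
Lemma res_proj_orthogonal n Q X :
  res_dim_le xi (xi_projective xi) n Q -> syzygy_orthogonal X -> orthogonal X Q.
Proof.
elim: n Q X => [|n IH] Q X /=; first by move=> projQ /syzygy_orthogonal0; apply.
move=> [Q' [P [q [p [dQ [projP hQ hQ']]]]]] hX.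
have [K [P0 [x [y [d [projP0 h]]]]]] := hP X.
have hK := syzygy_orthogonalS projP0 h hX.
have [K1 [P1 [x1 [y1 [d1 [projP1 h1]]]]]] := hP K.
have oXP := syzygy_orthogonal0 hX projP.
split=> [u hu|e he].
  have [|w hw] := pull_eq0_lift (xi_etri hQ) (c := u).
    by apply: (IH _ _ hQ' hX).2; apply/xi_ext_pull/(xi_xi_ext hQ).
  have [|z hz] := hom_defl_exact (xi_etri hQ) (f := w \oc y).
    by rewrite compA hw hu.
  (* Composition with [q] is injective only on maps from projectives, so [z \oc x] is tested on the
     presentation [P1] of [K]. *)
  have zx : z \oc x = 0.
    apply: (orthogonal_monic (IH _ _ hQ' hK) h1).
    apply: (proj_mono projP1 hQ).
    by rewrite !compA -hz -(compA w) (etri_comp0 (xi_etri h)) compm0 comp0m.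
  have [z' hz'] := hom_infl_exact (xi_etri h) zx.
  have wz : w - q \oc z' = 0.
    apply: (orthogonal_monic oXP h).
    by rewrite compBl hz hz' compA subrr.
  move/eqP: wz; rewrite subr_eq0 => /eqP wz.
  by rewrite -hw wz compA (etri_comp0 (xi_etri hQ)) comp0m.
have [|v <-] := pull_defl_exact (xi_etri h) (e := e).
  exact: proj_pull0.
have [|w hw] := pull_eq0_lift (xi_etri hQ) (c := v).
  by apply: (IH _ _ hQ' hK).2; apply/xi_ext_pull/(xi_xi_ext hQ).
have [w' hw'] := orthogonal_extend oXP h w.
by rewrite -hw -hw' compA pushM (push_infl (xi_etri h)) pushr0.
Qed.

(** * Coinductive description of xi-Gprojectives *)

Definition cosyzygy_class (S : C -> Prop) : Prop :=
  forall X, S X -> syzygy_orthogonal X /\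
    exists X' P (x : hom X P) (y : hom P X') (d : E X' X),
      [/\ xi_projective xi P, xi x y d & S X'].

(** Impredicative coinduction: the union of all cosyzygy classes, which is the largest one.
    Membership is proved by exhibiting a class. *)
Definition Gprojective X : Prop := exists2 S, cosyzygy_class S & S X.

Lemma Gprojective_syzygy_orthogonal X : Gprojective X -> syzygy_orthogonal X.
Proof. by move=> [S hS /hS[]]. Qed.

Lemma Gprojective_cosyzygy X : Gprojective X ->
  exists X' P (x : hom X P) (y : hom P X') (d : E X' X),
    [/\ xi_projective xi P, xi x y d & Gprojective X'].
Proof.
move=> [S hS /hS[_ [X' [P [x [y [d [projP h hX']]]]]]]].
by exists X', P, x, y, d; split=> //; exists S.
Qed.

Lemma Gprojective_class : cosyzygy_class Gprojective.
Proof.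
move=> X hX; split; first exact: Gprojective_syzygy_orthogonal.
exact: Gprojective_cosyzygy.
Qed.

(** Adjoining [K] to the class is consistent, because [X] is a cosyzygy of [K]. *)
Lemma Gprojective_syzygy X K P (x : hom K P) (y : hom P X) (d : E X K) :
  xi_projective xi P -> xi x y d -> Gprojective X -> Gprojective K.
Proof.
move=> projP h hX; exists (fun Y => Gprojective Y \/ Y = K); last by right.
move=> Y [/Gprojective_class[oY [X' [Q [u [v [e [projQ h' hX']]]]]]]|->].
  by split=> //; exists X', Q, u, v, e; split=> //; left.
split; last by exists X, P, x, y, d; split=> //; left.
exact: (syzygy_orthogonalS projP h (Gprojective_syzygy_orthogonal hX)).
Qed.

Lemma proj_Gprojective P : xi_projective xi P -> Gprojective P.
Proof.
exists (xi_projective xi) => // Q projQ.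
split; first exact: proj_syzygy_orthogonal.
have [O hO] := has_zero C.
exists O, Q, (idm Q), 0, 0; split=> //; last exact: (proj_zero hO).
exact: (xi_split (biproduct_zero Q hO)).
Qed.

(** * Comparison with complete resolutions *)

Section CompleteResolutionOf.
Variables (S : C -> Prop) (hS : cosyzygy_class S).

Lemma cosyzygy_coresolution X : S X ->
  exists k : nat -> C, [/\ k 0 = X, forall n, S (k n) & forall n,
    exists P (x : hom (k n) P) (y : hom P (k n.+1)) (d : E (k n.+1) (k n)),
      xi_projective xi P /\ xi x y d].
Proof.
move=> SX.
have next (Y : {Y | S Y}) : {Z : {Z | S Z} |
    exists P (x : hom (sval Y) P) (y : hom P (sval Z)) (d : E (sval Z) (sval Y)),
      xi_projective xi P /\ xi x y d}.
  case: Y => Y SY; apply: cid.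
  have [_ [Z [P [x [y [d [projP h SZ]]]]]]] := hS SY.
  by exists (exist S Z SZ), P, x, y, d.
pose k n := iter n (fun Y : {Y | S Y} => sval (next Y)) (exist S X SX).
exists (fun n => sval (k n)); split=> // n; first exact: svalP.
exact: (svalP (next (k n))).
Qed.

(** A projective resolution in degrees at least 0 is spliced at [X] with a coresolution in negative
    degrees; orthogonality gives hom-exactness. *)
Lemma cosyzygy_class_Gprojective X : S X -> xi_Gprojective xi X.
Proof.
move=> SX.
have [kn [kn0 Skn trin]] := cosyzygy_coresolution SX.
have [R] := projective_resolution_exists hP X.
pose K (z : int) := match z with Posz n => pres_K R n | Negz n => kn n.+1 end.
have oK z : Porthogonal (K z).
  apply: syzygy_orthogonal0; case: z => n /=; last by have [] := hS (Skn n.+1).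
  elim: n => [|n IH]; first by rewrite pres_K0; have [] := hS SX.
  exact: (syzygy_orthogonalS (pres_proj R n) (pres_xi R n) IH).
have tri z : {P : C & {x : hom (K (z + 1)) P & {y : hom P (K z) &
    {d : E (K z) (K (z + 1)) | xi_projective xi P /\ xi x y d}}}}.
  suff : exists P (x : hom (K (z + 1)) P) (y : hom P (K z))
      (d : E (K z) (K (z + 1))), xi_projective xi P /\ xi x y d.
    by move=> /cid[P] /cid[x] /cid[y] /cid[d h]; exists P, x, y, d.
  (* The cases are the resolution, the joint at [-1] where the triangle starts at [X], and the
     coresolution. *)
  case: z => [n|[|n]].
  - have -> : Posz n + 1 = Posz n.+1 by rewrite -PoszD addn1.
    exists (pres_P R n), (pres_g R n), (pres_f R n), (pres_d R n).
    by split; [apply: pres_proj | apply: pres_xi].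
  - have -> : Negz 0 + 1 = 0 by [].
    by rewrite /K /= pres_K0; move: (trin 0); rewrite kn0.
  have -> : Negz n.+1 + 1 = Negz n by rewrite !NegzE -addn1 PoszD opprD subrK.
  exact: trin.
have hR z := svalP (projT2 (projT2 (projT2 (tri z)))).
have Rex z := Porthogonal_exact (hR z).2 (oK z).
exists (CompleteResolution (fun z => (hR z).1) (fun z => (hR z).2) Rex), 0.
by rewrite /= pres_K0.
Qed.

End CompleteResolutionOf.

Lemma Gprojective_of_complete X : xi_Gprojective xi X -> Gprojective X.
Proof.
move=> [R [z0 ->]].
exists (fun Y => exists z, Y = cres_K R z); last by exists z0.
have oK k z : on_syzygies Porthogonal k (cres_K R z).
  elim: k z => [|k IH] z /=.
    exact: (exact_Porthogonal (cres_xi R z) (cres_proj R z) (cres_exact R z)).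
  move=> K P x y d projP h.
  (* An arbitrary syzygy of [cres_K R z] is a stable retract of the given one,
     [cres_K R (z + 1)]. *)
  apply: (on_syzygies_retract_closed Porthogonal_retract_closed) (IH (z + 1)).
  apply: (stable_retract_syzygy projP (cres_proj R z) h (cres_xi R z)).
  exact: (retract_stable (compm1 (idm _))).
move=> _ [z ->]; split=> [k|]; first exact: oK.
have -> : z = (z - 1) + 1 by rewrite subrK.
exists (cres_K R (z - 1)), (cres_P R (z - 1)), (cres_g R _), (cres_f R _).
exists (cres_d R (z - 1)); split; [exact: cres_proj | exact: cres_xi |].
by exists (z - 1).
Qed.

Lemma GprojectiveP X : xi_Gprojective xi X <-> Gprojective X.
Proof.
split; first exact: Gprojective_of_complete.
by move=> [S hS SX]; apply: (cosyzygy_class_Gprojective hS SX).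
Qed.

(** * Closure of xi-Gprojectives under stable retracts and extensions *)

Hypothesis hI : enough_injectives xi.

(** A [xi]-inflation of [A] into an injective extends along [f] and then along [g], so it factors
    through the composite. *)
Lemma xi_infl_comp A B D X F G (f : hom A B) (f' : hom B D) (d1 : E D A)
    (g : hom B X) (g' : hom X F) (d2 : E F B) (h' : hom X G) (d3 : E G A) :
  xi f f' d1 -> xi g g' d2 -> etri (g \oc f) h' d3 -> xi (g \oc f) h' d3.
Proof.
move=> h1 h2 t; have [I [K [x [y [d [injI hxy]]]]]] := hI A.
have [b hb] := inj_extend injI h1 x.
have [c hc] := inj_extend injI h2 b.
by apply: (xi_of_infl t hxy (k := c)); rewrite compA hc.
Qed.

Hypothesis hwic : WIC C.

(* If [id = b a + f t] with [t : X -> P], [a : X -> G], and [G -> P'' -> G'] is a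
   cosyzygy of [G], then [X -> P'' + P] is a xi-inflation by WIC, since maps into
   injectives extend along it; its cokernel is a stable retract of [G']. *)
Lemma Gprojective_retract_closed : retract_closed Gprojective.
Proof.
move=> X0 G0 h0 hG0.
exists (fun X => exists2 G, stable_retract X G & Gprojective G); last by exists G0.
move=> X [G hXG hG]; split.
  apply: (syzygy_orthogonal_retract_closed hXG).
  exact: Gprojective_syzygy_orthogonal.
have [P [a [b [t [f [projP e]]]]]] := hXG.
have [G' [P' [g [g' [dG [projP' hg hG']]]]]] := Gprojective_cosyzygy hG.
have oG' := syzygy_orthogonal0 (Gprojective_syzygy_orthogonal hG').
have [S [bS]] := has_biproduct P' P.
have projS := proj_biproduct bS projP' projP.
pose m := in1 bS \oc (g \oc a) + in2 bS \oc t.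
have m1 : pr1 bS \oc m = g \oc a.
  by rewrite compDr !(compA (pr1 bS)) pr1_in1 pr1_in2 comp1m comp0m addr0.
have m2 : pr2 bS \oc m = t.
  by rewrite compDr !(compA (pr2 bS)) pr2_in1 pr2_in2 comp1m comp0m add0r.
have [I [K [i [j [dI [injI hi]]]]]] := hI X.
have [k hk] : exists k, k \oc m = i.
  have [k hk] := inj_extend injI hg (i \oc b).
  exists (k \oc pr1 bS + i \oc f \oc pr2 bS).
  rewrite compDl -!compA m1 m2 (compA k) hk -(compA i) -compDr -e.
  exact: compm1.
have [|W [n [dW tm]]] := hwic.1 _ _ _ m k.
  by rewrite hk; exists K, j, dI; apply: xi_etri hi.
have hm := xi_of_infl tm hi hk.
exists W, S, m, n, dW; split=> //; exists G' => //.
have [|c [_ hc]] := etri_ET3 (a := a) (b := pr1 bS) tm (xi_etri hg).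
  exact: m1.
have [l hl] := orthogonal_extend (oG' S projS) hg (m \oc b).
have [r [_ hr]] := etri_ET3 (a := b) (b := l) (xi_etri hg) tm hl.
(* Pulling [dW] along [r \oc c] amounts to pushing it along [b \oc a]. This fixes [dW], because [t]
   factors through [m] and [push m dW = 0]. *)
have [|q hq] := pull_eq0_lift tm (c := idm W - r \oc c).
  rewrite pullBl pull1 pullM -hr -push_pull -hc -pushM.
  have {1}-> : dW = push (b \oc a) dW.
    rewrite -[LHS]push1 e pushDl (pushM f t).
    by rewrite -m2 (pushM (pr2 bS)) (push_infl tm) !pushr0 addr0.
  by rewrite subrr.
by exists S, c, r, q, n; rewrite hq addrC subrK.
Qed.

(** The pushout of [Y] along [X -> P] is a biproduct of [P] and [Z], since [Z] is orthogonal to [P].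
    Embedding [Z] into [P'] yields a cosyzygy [W] of [Y] that is an extension of [Z'] by [X']. *)
Lemma Gprojective_extension_closed : extension_closed Gprojective.
Proof.
move=> X0 Y0 Z0 x0 y0 d0 h0 hX0 hZ0.
exists (fun Y => exists X Z (x : hom X Y) (y : hom Y Z) (d : E Z X),
  [/\ xi x y d, Gprojective X & Gprojective Z]); last first.
  by exists X0, Z0, x0, y0, d0.
move=> Y [X [Z [x [y [d [h hX hZ]]]]]].
have oX := Gprojective_syzygy_orthogonal hX.
have oZ := Gprojective_syzygy_orthogonal hZ.
split; first exact: (syzygy_orthogonal_extension_closed h oX oZ).
have [X' [P [u [u' [dX [projP hu hX']]]]]] := Gprojective_cosyzygy hX.
have [Z' [P' [v [v' [dZ [projP' hv hZ']]]]]] := Gprojective_cosyzygy hZ.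
have [M [e2 [p1 [e1 [p2 [t1 t2]]]]]] := etri_pushout (xi_etri h) (xi_etri hu).
rewrite ((syzygy_orthogonal0 oZ projP).2 (push u d)) in t1; last first.
  exact/xi_ext_push/(xi_xi_ext h).
have [bM _] := split_biproduct t1.
have h2 := etri_xi t2 (xi_ext_push x (xi_xi_ext hu)).
have [O hO] := has_zero C; have [S [bS]] := has_biproduct P P'.
have hPO := xi_split (biproduct_zero P hO).
have h3 := proper_dsum hxi bM bS (zero_biproduct Z' hO) hPO hv.
move: h3; move: (hom_dsum bM bS _ _) (ext_dsum _ _ _ _) => m e3 h3.
have [W [w [d3 [q [r [t4 [_ _ t5 _ _]]]]]]] := etri_ET4 t2 (xi_etri h3).
exists W, S, (m \oc e1), w, d3; split.
- exact: (proj_biproduct bS).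
- exact: (xi_infl_comp h2 h3).
exists X', Z', q, r, (push p2 e3); split=> //.
exact/(etri_xi t5)/xi_ext_push/(xi_xi_ext h3).
Qed.

(* [X] is a stable retract of any cosyzygy [G] of [K]. *)
Lemma Gprojective_of_syzygy X K P (x : hom K P) (y : hom P X) (d : E X K) :
  xi_projective xi P -> xi x y d -> Gprojective K ->
  (forall Q, xi_projective xi Q ->
     forall v : hom K Q, exists w, w \oc x = v) ->
  Gprojective X.
Proof.
move=> projP h hK ext.
have [G [P' [g [g' [e [projP' hg hG]]]]]] := Gprojective_cosyzygy hK.
have oG := syzygy_orthogonal0 (Gprojective_syzygy_orthogonal hG).
(* Extending [g] over [P] and [x] over [P'] gives maps of triangles in both directions that are the
   identity on [K]. *)
have [u hu] := ext _ projP' g.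
have [v hv] := orthogonal_extend (oG _ projP) hg x.
have [|a [_ ha]] := etri_ET3 (a := idm K) (b := u) (xi_etri h) (xi_etri hg).
  by rewrite compm1.
have [|b [_ hb]] := etri_ET3 (a := idm K) (b := v) (xi_etri hg) (xi_etri h).
  by rewrite compm1.
rewrite !push1 in ha hb.
have [|t ht] := pull_eq0_lift (xi_etri h) (c := idm X - b \oc a).
  by rewrite pullBl pull1 pullM -hb -ha subrr.
apply: (Gprojective_retract_closed _ hG).
by exists P, a, b, t, y; rewrite ht addrC subrK.
Qed.

(** * The dimension read off from syzygies *)

Lemma Gprojective_on_syzygies n X : Gprojective X -> on_syzygies Gprojective n X.
Proof.
elim: n X => //= n IH X hX K P x y d projP h.
exact/IH/(Gprojective_syzygy projP h).
Qed.

Lemma on_syzygies_Gprojective_addn m k X :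
  on_syzygies Gprojective m X -> on_syzygies Gprojective (m + k) X.
Proof.
elim: m X => [|m IH] X; first exact: Gprojective_on_syzygies.
by move=> hX K P x y d projP h; apply: IH; apply: (hX _ _ _ _ _ projP h).
Qed.

(** Rotating twice makes [K], up to a projective summand, an extension of [M], itself [X] plus a
    projective, by a syzygy [KG] of [G]. *)
Lemma on_syzygies_Gprojective_cone n X G A (x : hom X G) (y : hom G A)
    (d : E A X) :
  xi x y d -> Gprojective G -> on_syzygies Gprojective n X ->
  on_syzygies Gprojective n.+1 A.
Proof.
move=> h hG hX K P k p e projP hK.
have [M [b [m [q [f hM]]]]] := xi_rotate h projP hK.
have [KG [PG [u [v [dG [projPG hu]]]]]] := hP G.
have [M' [b' [m' [q' [f' hM']]]]] := xi_rotate hM projPG hu.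
have rc := on_syzygies_retract_closed (k := n) Gprojective_retract_closed.
apply: (rc _ _ (stable_retract_addl b')).
apply: (on_syzygies_extension_closed Gprojective_retract_closed
  Gprojective_extension_closed hM').
  exact/Gprojective_on_syzygies/(Gprojective_syzygy projPG hu).
exact: (rc _ _ (stable_retract_addr b projP)).
Qed.

Lemma res_on_syzygies_Gprojective n A :
  res_dim_le xi (xi_Gprojective xi) n A -> on_syzygies Gprojective n A.
Proof.
elim: n A => [|n IH] A; first by move/GprojectiveP.
move=> [X [G [x [y [d [hG h hX]]]]]].
by apply: (on_syzygies_Gprojective_cone h); [apply/GprojectiveP | apply: IH].
Qed.

Section Resolution.
Variables (A : C) (R : projective_resolution xi A).

Lemma on_syzygies_pres W n k :
  on_syzygies W (n + k) A -> on_syzygies W k (pres_K R n).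
Proof.
elim: n k => [|n IH] k; first by rewrite pres_K0.
rewrite addSnnS => /IH hn.
exact: (hn _ _ _ _ _ (pres_proj R n) (pres_xi R n)).
Qed.

Lemma res_dim_le_pres (W : C -> Prop) n k :
  (forall P, xi_projective xi P -> W P) ->
  res_dim_le xi W k (pres_K R n) -> res_dim_le xi W (n + k) A.
Proof.
move=> hW; elim: n k => [|n IH] k; first by rewrite pres_K0.
move=> hn; rewrite addSnnS; apply: IH.
exists (pres_K R n.+1), (pres_P R n), (pres_g R n), (pres_f R n), (pres_d R n).
by split=> //; [apply/hW/pres_proj | apply: pres_xi].
Qed.

(** Truncating [R] at [n] gives a resolution of length [n]; conversely one of length [m] makes all
    [m]-th syzygies Gprojective, and so all later ones. *)
Lemma xi_Gpd_leP n :
  (exists2 m, (m <= n)%N & res_dim_le xi (xi_Gprojective xi) m A) <->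
  Gprojective (pres_K R n).
Proof.
split=> [[m mn /res_on_syzygies_Gprojective hm]|hn].
  suff : on_syzygies Gprojective (n + 0) A by move/on_syzygies_pres.
  by rewrite addn0 -(subnKC mn); apply: on_syzygies_Gprojective_addn.
exists n => //; rewrite -[n]addn0; apply: res_dim_le_pres.
  by move=> P projP; apply/GprojectiveP/proj_Gprojective.
exact/GprojectiveP.
Qed.

Lemma Gprojective_pres n j : (n <= j)%N ->
  Gprojective (pres_K R n) -> Gprojective (pres_K R j).
Proof.
move=> nj /xi_Gpd_leP[m mn hm]; apply/xi_Gpd_leP.
by exists m => //; apply: leq_trans nj.
Qed.

(** * Vanishing of xixt and descent along the resolution *)

Lemma xi_xtS_eq0 Q i : zero_group (xi_xt R Q i.+1) <->
  forall u : hom (pres_P R i.+1) Q, u \oc pres_diff R i.+1 = 0 ->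
    exists w : hom (pres_P R i) Q, w \oc pres_diff R i = u.
Proof. exact: zero_group_cohomologyS. Qed.

(** Orthogonality of the syzygy of index [i.+2] makes a cocycle on [pres_P R i.+1] factor through
    [pres_K R i.+1]; that of index [i] extends the factor to [pres_P R i]. *)
Lemma xi_xt_eq0 n Q m i : Gprojective (pres_K R n) ->
  res_dim_le xi (xi_projective xi) m Q -> (n + 1 <= i)%N ->
  zero_group (xi_xt R Q i).
Proof.
move=> hn hQ; rewrite addn1; case: i => // i ni; apply/xi_xtS_eq0 => u.
have oK j : (n <= j)%N -> orthogonal (pres_K R j) Q.
  move=> nj; apply: (res_proj_orthogonal hQ).
  exact/Gprojective_syzygy_orthogonal/(Gprojective_pres nj).
rewrite /pres_diff compA => hu.
have ug := orthogonal_monic (oK i.+2 _) (pres_xi R i.+2) hu.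
have [|v hv] := hom_infl_exact (xi_etri (pres_xi R i.+1)) (f := u).
  by apply: ug; do 2![apply: leqW].
have [w hw] := orthogonal_extend (oK i ni) (pres_xi R i) v.
by exists w; rewrite compA hw.
Qed.

Lemma Gprojective_of_xi_xt n m : (n <= m)%N -> Gprojective (pres_K R m) ->
  (forall Q, xi_projective xi Q ->
     forall i, (n + 1 <= i)%N -> zero_group (xi_xt R Q i)) ->
  Gprojective (pres_K R n).
Proof.
move=> nm hm hQ; move: hm; rewrite -(subnKC nm).
elim: (m - n)%N => [|k IH]; rewrite ?addn0 // addnS => hk; apply: IH.
set j := (n + k)%N in hk *.
apply: (Gprojective_of_syzygy (pres_proj R j) (pres_xi R j) hk) => Q projQ v.
have oj := syzygy_orthogonal0 (Gprojective_syzygy_orthogonal hk) projQ.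
have hj : (n + 1 <= j.+1)%N by rewrite addn1 ltnS leq_addr.
have [|w hw] := (xi_xtS_eq0 Q j).1 (hQ Q projQ _ hj) (v \oc pres_f R j.+1).
  rewrite /pres_diff compA -(compA v) (etri_comp0 (xi_etri (pres_xi R j.+1))).
  by rewrite compm0 comp0m.
exists w; apply/eqP; rewrite -subr_eq0; apply/eqP.
(* The deflation [pres_f R j.+1] need not be an epimorphism; orthogonality of [pres_K R j.+1] allows
   cancelling it. *)
apply: (orthogonal_monic oj (pres_xi R j.+1)).
by rewrite compBl -compA hw subrr.
Qed.

End Resolution.
End ProperClass.

(** * Infima and suprema in the extended naturals *)

Lemma enat_inf_leP (S : nat -> Prop) n :
  enat_le (enat_inf S) (Some n) <-> exists2 m, (m <= n)%N & S m.
Proof.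
rewrite /enat_inf; case: pselect => [ex|nex] /=.
  case: ex_minnP => k /asboolP Sk min; split=> [kn|[m mn Sm]]; first by exists k.
  by apply: leq_trans mn; apply: min; apply/asboolP.
by split=> // -[m _ Sm]; case: nex; exists m; apply/asboolP.
Qed.

Lemma enat_inf_finite (S : nat -> Prop) : enat_inf S <> None <-> exists m, S m.
Proof.
rewrite /enat_inf; case: pselect => [ex|nex] /=; split=> //.
  by move=> _; case: ex => m /asboolP; exists m.
by move=> [m Sm]; case: nex; exists m; apply/asboolP.
Qed.

Lemma enat_sup_leP (S : nat -> Prop) n :
  enat_le (enat_sup S) (Some n) <-> forall i, S i -> (i <= n)%N.
Proof.
rewrite enat_inf_leP; split=> [[m mn hm] i /hm im|h]; last by exists n.
exact: leq_trans mn.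
Qed.

Lemma enat_le_eq u v :
  (forall n, enat_le u (Some n) <-> enat_le v (Some n)) -> u = v.
Proof.
case: u v => [m|] [n|] h //=.
- by congr Some; apply/anti_leq/andP; split;
    [apply: (h n).2 | apply: (h m).1] => /=.
- by case: (h m) => /(_ (leqnn m)).
by case: (h n) => _ /(_ (leqnn n)).
Qed.

(** * Equivalences and supremum formulas for the dimension *)

Theorem theorem3p8 (C : extriCat) (hwic : WIC C)
    (xi : triclass (ext_of C)) (hxi : proper_class xi)
    (hP : enough_projectives xi) (hI : enough_injectives xi)
    (M : C) (hM : finite_xi_Gpd xi M)
    (R : projective_resolution xi M) (n : nat) :
  ((enat_le (xi_Gpd xi M) (Some n) <->
      (forall Q : C, finite_xi_pd xi Q ->
         forall i : nat, (n + 1 <= i)%N -> zero_group (xi_xt R Q i))) /\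
   (enat_le (xi_Gpd xi M) (Some n) <->
      (forall Q : C, xi_projective xi Q ->
         forall i : nat, (n + 1 <= i)%N -> zero_group (xi_xt R Q i)))) /\
  (xi_Gpd xi M =
     enat_sup (fun i => exists Q : C,
       xi_projective xi Q /\ ~ zero_group (xi_xt R Q i)) /\
   xi_Gpd xi M =
     enat_sup (fun i => exists Q : C,
       finite_xi_pd xi Q /\ ~ zero_group (xi_xt R Q i))).
Proof.
(* Finiteness of the dimension supplies the index [m0] from which the descent starts. *)
have [m0 hm0] := (enat_inf_finite _).1 hM.
have GpdP k : enat_le (xi_Gpd xi M) (Some k) <-> Gprojective xi (pres_K R k).
  by rewrite enat_inf_leP; apply: xi_Gpd_leP.
have Gm0 : Gprojective xi (pres_K R m0).
  by apply/(xi_Gpd_leP hxi hP hI hwic R); exists m0.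
have finite_proj Q : xi_projective xi Q -> finite_xi_pd xi Q.
  by move=> projQ; apply/enat_inf_finite; exists 0.
have vanish k : enat_le (xi_Gpd xi M) (Some k) -> forall Q, finite_xi_pd xi Q ->
    forall i, (k + 1 <= i)%N -> zero_group (xi_xt R Q i).
  move=> /GpdP hk Q /enat_inf_finite[m hQ] i.
  exact: (xi_xt_eq0 hxi hP hI hwic hk hQ).
have bound k : (forall Q, xi_projective xi Q ->
    forall i, (k + 1 <= i)%N -> zero_group (xi_xt R Q i)) ->
    enat_le (xi_Gpd xi M) (Some k).
  (* Up to [m0] the vanishing drives the descent from [m0] to [k]; beyond [m0] later syzygies stay
     Gprojective. *)
  move=> hk; apply/GpdP; have [km|mk] := leqP k m0.
    exact: (Gprojective_of_xi_xt hxi hP hI hwic km Gm0).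
  exact: (Gprojective_pres hxi hP hI hwic (ltnW mk)).
(* Both formulas are instances of one for a class [W] between the projectives and the objects of
   finite projective dimension. *)
have sup (W : C -> Prop) : (forall Q, xi_projective xi Q -> W Q) ->
    (forall Q, W Q -> finite_xi_pd xi Q) ->
    xi_Gpd xi M = enat_sup (fun i => exists Q, W Q /\ ~ zero_group (xi_xt R Q i)).
  move=> projW Wfin; apply: enat_le_eq => k; rewrite enat_sup_leP.
  split=> [/vanish hk i [Q [/Wfin WQ nz]]|hk].
    by rewrite leqNgt; apply/negP => ki; apply: nz; apply: hk; rewrite ?addn1.
  apply: bound => Q projQ i; rewrite addn1 => ki; apply: contrapT => nz.
  suff : (i <= k)%N by rewrite leqNgt ki.
  by apply: hk; exists Q; split=> //; apply: projW.
split; last by split; apply: sup.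
split; split; try exact: vanish.
- by move=> h; apply: bound => Q /finite_proj; apply: h.
- by move=> /vanish h Q /finite_proj; apply: h.
- exact: bound.
Qed.
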